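(* The problem Deletion Blocker($\alpha$) is solvable in polynomial time when the input graph is restricted to be a co-comparability graph. That is, there is a polynomial-time algorithm which, given a co-comparability graph $G=(V,E)$ and two integers $d,k\geq 1$, decides whether there exists a set $S\subseteq V$ with $|S|\leq k$ such that $\alpha(G-S)\leq \alpha(G)-d$.
   Context: All graphs are finite and undirected, without self-loops or multiple edges. A comparability graph is a graph $H=(V,F)$ admitting a transitive ordering of its vertices, i.e. a linear ordering $\prec$ of $V$ such that if $u\prec v\prec w$ and $uv,vw\in F$, then $uw\in F$. A co-comparability graph is the complement of a comparability graph. $\alpha(G)$ denotes the size of a largest independent set of $G$, and $G-S$ denotes the subgraph of $G$ induced by $V\setminus S$. Problem Deletion Blocker($\alpha$). Instance: a graph $G=(V,E)$ and two integers $d,k\geq 1$. Question: is there a set $S\subseteq V$ with $|S|\leq k$ such that $\alpha(G-S)\leq\alpha(G)-d$? *)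

(* Defs.v *)
From HB Require Import structures.
From mathcomp Require Import all_boot all_order all_algebra.

Set Implicit Arguments.
Unset Strict Implicit.
Unset Printing Implicit Defensive.

(** * Graphs *)

Record sgraph (T : finType) := SGraph {
  edge : rel T;
  edge_sym : symmetric edge;
  edge_irr : irreflexive edge
}.

Section Graphs.
Variables (T : finType) (G : sgraph T).

Lemma compl_sym : symmetric [rel u v | (u != v) && ~~ edge G u v].
Proof. by move=> u v /=; rewrite eq_sym edge_sym. Qed.

Lemma compl_irr : irreflexive [rel u v | (u != v) && ~~ edge G u v].
Proof. by move=> u /=; rewrite eqxx. Qed.

Definition compl_graph : sgraph T := SGraph compl_sym compl_irr.

Definition linear_ordering (prec : rel T) : Prop :=
  [/\ irreflexive prec, transitive prec &
      forall u v, u != v -> prec u v || prec v u].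

Definition transitive_ordering (prec : rel T) : Prop :=
  linear_ordering prec /\
  forall u v w, prec u v -> prec v w ->
    edge G u v -> edge G v w -> edge G u w.

Definition comparability : Prop := exists prec, transitive_ordering prec.

Definition independent (A : {set T}) : bool :=
  [forall u in A, forall v in A, ~~ edge G u v].

Definition alpha : nat := \max_(A : {set T} | independent A) #|A|.

Variable A : {set T}.

Lemma induced_sym :
  symmetric [rel u v : {x : T | x \in A} | edge G (val u) (val v)].
Proof. by move=> u v /=; rewrite edge_sym. Qed.

Lemma induced_irr :
  irreflexive [rel u v : {x : T | x \in A} | edge G (val u) (val v)].
Proof. by move=> u /=; rewrite edge_irr. Qed.

Definition induced : sgraph {x : T | x \in A} := SGraph induced_sym induced_irr.

End Graphs.

Definition cocomparability (T : finType) (G : sgraph T) : Prop :=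
  comparability (compl_graph G).

Definition delete (T : finType) (G : sgraph T) (S : {set T}) :=
  induced G (~: S).

(* The inequality is stated in [int], so that the right-hand side may be
   negative. *)
Definition deletion_blocker_alpha (T : finType) (G : sgraph T) (d k : nat) :
    Prop :=
  exists S : {set T}, #|S| <= k /\
    ((alpha (delete G S))%:Z <= (alpha G)%:Z - d%:Z)%R.

(** * Model of computation

   Structured programs for a random access machine over the natural numbers,
   under the uniform cost criterion.  Variables, and arrays with two indices,
   are named by natural numbers; a program mentions finitely many names.  The
   only arithmetic is addition and truncated subtraction: without
   multiplication each unit of time lengthens the binary representation of the
   largest stored number by at most a constant, so that time on this machine
   and on a multitape Turing machine are polynomially related (Cook and
   Reckhow, Time bounded random access machines, 1973). *)

Inductive expr :=
  | Cst of nat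
  | Var of nat
  | Get of nat & expr & expr
  | Add of expr & expr
  | Sub of expr & expr.

Inductive cmd :=
  | Skip
  | Assign of nat & expr
  | Store of nat & expr & expr & expr
  | Seq of cmd & cmd
  | If of expr & cmd & cmd
  | While of expr & cmd.

Record state := State {
  vars : nat -> nat;
  arrs : nat -> nat -> nat -> nat
}.

Fixpoint eval (s : state) (e : expr) : nat :=
  match e with
  | Cst c => c
  | Var x => vars s x
  | Get a i j => arrs s a (eval s i) (eval s j)
  | Add e1 e2 => eval s e1 + eval s e2
  | Sub e1 e2 => eval s e1 - eval s e2
  end.

Fixpoint cost (e : expr) : nat :=
  match e with
  | Cst _ | Var _ => 1
  | Get _ e1 e2 | Add e1 e2 | Sub e1 e2 => (cost e1 + cost e2).+1
  end.

Definition set_var (s : state) (x v : nat) : state :=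
  State (fun y => if y == x then v else vars s y) (arrs s).

Definition set_cell (s : state) (a i j v : nat) : state :=
  State (vars s)
    (fun b i' j' => if [&& b == a, i' == i & j' == j] then v
                    else arrs s b i' j').

(* [exec c s t s']: started in [s], the program [c] halts in [s'] after [t]
   units of time.  A test succeeds when its value is nonzero. *)
Inductive exec : cmd -> state -> nat -> state -> Prop :=
  | exec_skip s : exec Skip s 1 s
  | exec_assign x e s :
      exec (Assign x e) s (cost e).+1 (set_var s x (eval s e))
  | exec_store a i j e s :
      exec (Store a i j e) s (cost i + cost j + cost e).+1
        (set_cell s a (eval s i) (eval s j) (eval s e))
  | exec_seq c1 c2 s t1 s1 t2 s2 :
      exec c1 s t1 s1 -> exec c2 s1 t2 s2 ->
      exec (Seq c1 c2) s (t1 + t2).+1 s2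
  | exec_if_true e c1 c2 s t s' :
      eval s e != 0 -> exec c1 s t s' ->
      exec (If e c1 c2) s (cost e + t).+1 s'
  | exec_if_false e c1 c2 s t s' :
      eval s e == 0 -> exec c2 s t s' ->
      exec (If e c1 c2) s (cost e + t).+1 s'
  | exec_while_true e c s t1 s1 t2 s2 :
      eval s e != 0 -> exec c s t1 s1 -> exec (While e c) s1 t2 s2 ->
      exec (While e c) s (cost e + t1 + t2).+1 s2
  | exec_while_false e c s :
      eval s e == 0 -> exec (While e c) s (cost e).+1 s.

(* A program and an initial state determine the running time and the result. *)
Lemma exec_deterministic c s t1 s1 t2 s2 :
  exec c s t1 s1 -> exec c s t2 s2 -> t1 = t2 /\ s1 = s2.
Proof.
move=> ex; elim: ex t2 s2 => {c s t1 s1}; intros;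
  match goal with ex : exec _ _ ?t ?s |- _ = ?t /\ _ = ?s =>
    inversion ex; clear ex; subst
  end; try done;
  try (match goal with H : is_true (?a != 0), H' : is_true (?a == 0) |- _ =>
    by rewrite H' in H
  end);
  repeat match goal with
  | IH : forall t s, exec ?c ?s0 t s -> _, ex : exec ?c ?s0 _ _ |- _ =>
      have [? ?] := IH _ _ ex; clear IH; subst
  end; done.
Qed.

(** * Encoding of instances

   The vertices are 0, ..., n-1.  Variables 0, 1, 2 hold n, d, k and array 0
   holds the adjacency matrix; the rest of the memory is zero.  The answer is
   read in variable 0. *)

Definition input (n : nat) (G : sgraph 'I_n) (d k : nat) : state :=
  State
    (fun x => match x with 0 => n | 1 => d | 2 => k | _ => 0 end)
    (fun a i j =>
       match a, insub i, insub j with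
       | 0, Some u, Some v => edge G u v : nat
       | _, _, _ => 0
       end).

Definition accepts (s : state) : Prop := vars s 0 != 0.

(* Number of bits of the adjacency matrix and of the binary representations of
   [d] and [k]. *)
Definition input_size (n d k : nat) : nat :=
  n ^ 2 + (trunc_log 2 d).+1 + (trunc_log 2 k).+1.

(* Main.v *)
Require Import Defs.
From HB Require Import structures.
From mathcomp Require Import all_boot all_order all_algebra.
From mathcomp Require Import zify.

(** Let [H] be the complement of [G].  An independent set of [G] is a chain of
    any transitive orientation [D] of [H], so the largest number [f m] of
    vertices that can be kept with independence number at most [m] is the
    largest size of a union of [m] antichains of [D].  Since
    [alpha G <= m] iff [f m = n], the function [f] also gives [alpha G], and the
    answer is yes iff [d <= alpha G] and [n <= k + f (alpha G - d)].

    [D] is found by the lexicographic rule of Hell and Huang: orient the first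
    unoriented edge [xy] from [x] to [y] and propagate the orientations forced
    by non-edges.  Comparability of [H] excludes conflicts, and the triangle
    lemma shows that the result has no cyclic triangle.

    By Saks's theorem [f m] is the width of the product of [D] with a chain of
    length [m].  By Dilworth and Koenig it is the number of nodes left
    unmatched by a maximum matching in the comparability bipartite graph, found
    by an auction: an unmatched lower node [x] with label [q x] takes an upper
    neighbour [y] of price [p y <= q x], raises the price to [q x + 1] and evicts
    the previous owner; if there is none, [q x] increases.  A bidder whose label
    exceeds the number of nodes gives up.  At the end some price level [l] is
    not used, and the nodes with [p z < l <= q z] form a maximum antichain. *)

Set Implicit Arguments.
Unset Strict Implicit.
Unset Printing Implicit Defensive.

(** * Loop programs and their running time *)

Definition memory := nat -> nat -> nat -> nat.
Definition env := nat -> nat.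

(** Every loop runs [n + c] times, where [n] is the value of variable 0. Hence programs terminate by
    construction, have a functional meaning, and admit a time bound that can be read off the
    syntax. *)
Inductive prog :=
  | PStore of nat & expr & expr & expr
  | PSeq of prog & prog
  | PWhen of expr & prog
  | PFor of nat & nat & prog.

Definition bind (r : env) (x v : nat) : env := fun y => if y == x then v else r y.

Definition upd (m : memory) (a i j v : nat) : memory :=
  fun b i' j' => if [&& b == a, i' == i & j' == j] then v else m b i' j'.

Fixpoint run (p : prog) (r : env) (m : memory) : memory :=
  match p with
  | PStore a i j e =>
      let s := State r m in upd m a (eval s i) (eval s j) (eval s e)
  | PSeq p1 p2 => run p2 r (run p1 r m)
  | PWhen e p1 => if eval (State r m) e != 0 then run p1 r m else m
  | PFor x c p1 => iteri (r 0 + c) (fun i => run p1 (bind r x i)) m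
  end.

Lemma run_for (r : env) n x p m : r 0 = n ->
  run (PFor x 0 p) r m = iteri n (fun i => run p (bind r x i)) m.
Proof. by move=> <- /=; rewrite addn0. Qed.

Lemma run_seq p1 p2 r m : run (PSeq p1 p2) r m = run p2 r (run p1 r m).
Proof. by []. Qed.

Lemma run_when e p r m :
  run (PWhen e p) r m = if eval (State r m) e != 0 then run p r m else m.
Proof. by []. Qed.

Lemma run_store a i j e r m : let s := State r m in
  run (PStore a i j e) r m = upd m a (eval s i) (eval s j) (eval s e).
Proof. by []. Qed.

Fixpoint compile (p : prog) : cmd :=
  match p with
  | PStore a i j e => Store a i j e
  | PSeq p1 p2 => Seq (compile p1) (compile p2)
  | PWhen e p1 => If e (compile p1) Skip
  | PFor x c p1 =>
      Seq (Assign x (Cst 0))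
        (While (Defs.Sub (Add (Var 0) (Cst c)) (Var x))
           (Seq (compile p1) (Assign x (Add (Var x) (Cst 1)))))
  end.

Fixpoint expr_in (sc : seq nat) (e : expr) : bool :=
  match e with
  | Cst _ => true
  | Var x => x \in sc
  | Get _ e1 e2 | Add e1 e2 | Defs.Sub e1 e2 => expr_in sc e1 && expr_in sc e2
  end.

(* The scope [sc] lists the variables that may be read; a loop variable leaves
   the scope when its loop ends, so its final value is irrelevant. *)
Fixpoint prog_in (sc : seq nat) (p : prog) : bool :=
  match p with
  | PStore _ i j e => [&& expr_in sc i, expr_in sc j & expr_in sc e]
  | PSeq p1 p2 => prog_in sc p1 && prog_in sc p2
  | PWhen e p1 => expr_in sc e && prog_in sc p1
  | PFor x _ p1 => [&& x \notin sc, 0 \in sc & prog_in (x :: sc) p1]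
  end.

(** A bound as a polynomial in the value of variable 0. In a loop, 12 covers the test and the
    increment of one round, and 9 the initialisation and the failing test. *)
Fixpoint time (p : prog) : {poly nat} :=
  match p with
  | PStore a i j e => ((cost i + cost j + cost e).+1)%:P
  | PSeq p1 p2 => time p1 + time p2 + 1
  | PWhen e p1 => time p1 + ((cost e).+2)%:P
  | PFor x c p1 => ('X + c%:P) * (time p1 + 12%:P) + 9%:P
  end%R.

Lemma eval_in sc e r r' m :
  expr_in sc e -> {in sc, r =1 r'} -> eval (State r m) e = eval (State r' m) e.
Proof.
move=> + rr'; elim: e => [//|x /rr'//|a e1 IH1 e2 IH2|e1 IH1 e2 IH2|e1 IH1 e2 IH2] /=;
by case/andP=> /IH1-> /IH2->.
Qed.

(** Agreement is required on the scope only, because compiled code leaves the final values of its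
    loop variables behind. *)
Lemma exec_compile sc p s r :
  prog_in sc p -> {in sc, vars s =1 r} ->
  exists t s', [/\ exec (compile p) s t s', t <= (time p).[r 0]%R,
    arrs s' = run p r (arrs s) & {in sc, vars s' =1 r}].
Proof.
elim: p sc s r => [a i j e|p1 IH1 p2 IH2|e p1 IH1|x c p1 IH1] sc s r /=.
- case/and3P=> Hi Hj He sr.
  exists (cost i + cost j + cost e).+1, (set_cell s a (eval s i) (eval s j) (eval s e)).
  split=> //; first exact: exec_store.
    by rewrite hornerC.
  case: s sr => v m /= sr.
  by rewrite (eval_in m Hi sr) (eval_in m Hj sr) (eval_in m He sr).
- case/andP=> /IH1{}IH1 /IH2{}IH2 /IH1[t1 [s1 [ex1 l1 a1 /IH2[t2 [s2 [ex2 l2 a2 v2]]]]]].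
  exists (t1 + t2).+1, s2; split=> //; first exact: exec_seq ex1 ex2.
    by rewrite !hornerD hornerC; move: l1 l2; lia.
  by rewrite a2 a1.
- case/andP=> He /IH1{}IH1 sr; have [t1 [s1 [ex1 l1 a1 v1]]] := IH1 _ _ sr.
  have Ee : eval s e = eval (State r (arrs s)) e.
    by case: (s) sr => v m /= sr; exact: eval_in sr.
  rewrite hornerD hornerC -Ee; case: eqP => [E|/eqP E].
    exists (cost e + 1).+1, s; split=> //; last by lia.
    by apply: exec_if_false; [rewrite E|exact: exec_skip].
  exists (cost e + t1).+1, s1; split=> //; last by move: l1; lia.
  exact: exec_if_true.
- case/and3P=> Hx H0 Hp sr.
  (* Variable 0 is in scope and [x] is not, so binding [x] leaves the loop bound [r 0] unchanged. *)
  have x0 : (0 == x) = false by apply/eqP=> E; rewrite -E H0 in Hx.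
  set T := ((time p1).[r 0])%R.
  (* Invariant after [i] rounds with [k] to go; the final 6 is the cost of the failing test. *)
  suff loop k i s1 : k + i = r 0 + c -> vars s1 x = i -> {in sc, vars s1 =1 r} ->
    arrs s1 = iteri i (fun i => run p1 (bind r x i)) (arrs s) ->
    exists t s', [/\ exec (While (Defs.Sub (Add (Var 0) (Cst c)) (Var x))
           (Seq (compile p1) (Assign x (Add (Var x) (Cst 1))))) s1 t s',
      t <= k * (T + 12) + 6,
      arrs s' = iteri (r 0 + c) (fun i => run p1 (bind r x i)) (arrs s) &
      {in sc, vars s' =1 r}].
    have [||y ysc||t [s' [ex l a v]]] := loop (r 0 + c) 0 (set_var s x 0) => //.
    + by rewrite addn0.
    + by rewrite /= eqxx.
    + by rewrite /= (negPf (memPn Hx y ysc)) sr.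
    exists (2 + t).+1, s'; split=> //.
      by apply: exec_seq ex; exact: exec_assign.
    rewrite hornerD hornerM !hornerD !hornerC hornerX -/T.
    rewrite -[leqRHS]/((r 0 + c) * (T + 12) + 9); move: l; lia.
  elim: k i s1 => [|k IH] i s1 Ek vx vs as1.
    exists 6, s1; split=> //; last by rewrite as1 -Ek.
    by apply: exec_while_false => /=; rewrite vx vs // -Ek subn_eq0.
  have [y /predU1P[->|ysc]|t1 [s2 [ex1 l1 a2 v2]]] := IH1 _ s1 (bind r x i) Hp.
  + by rewrite /bind eqxx.
  + by rewrite /bind (negPf (memPn Hx y ysc)) vs.
  pose s3 := set_var s2 x (vars s2 x + 1).
  have vx2 : vars s2 x = i by rewrite v2 ?mem_head // /bind eqxx.
  have [||y ysc||t3 [s4 [ex3 l3 a4 v4]]] := IH i.+1 s3.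
  + by rewrite addnS.
  + by rewrite /= eqxx vx2 addn1.
  + rewrite /= (negPf (memPn Hx y ysc)) v2 ?inE ?ysc ?orbT //.
    by rewrite /bind (negPf (memPn Hx y ysc)).
  + by rewrite /= a2 as1.
  exists (5 + (t1 + 4).+1 + t3).+1, s4; split=> //.
    apply: exec_while_true ex3; first by rewrite /= vx vs // -Ek; lia.
    by apply: exec_seq ex1 _; exact: exec_assign.
  move: l1 l3; rewrite /bind x0 -/T; nia.
Qed.

Lemma leq_horner (p : {poly nat}) a b : a <= b -> p.[a]%R <= p.[b]%R.
Proof.
move=> ab; rewrite !horner_coef; apply: leq_sum => i _.
by rewrite leq_mul2l; apply/orP; right; elim: {i}(nat_of_ord i) => // i IH; rewrite !GRing.exprS leq_mul.
Qed.

(** * Tests as arithmetic expressions, nonzero meaning true *)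

Definition eNot e := Defs.Sub (Cst 1) e.
Definition eAnd e f := eNot (Add (eNot e) (eNot f)).
Definition eOr e f := Add e f.
Definition eLe e f := eNot (Defs.Sub e f).
Definition eLt e f := eNot (eLe f e).
Definition eEq e f := eAnd (eLe e f) (eLe f e).

Lemma evalNot s e : (eval s (eNot e) != 0) = ~~ (eval s e != 0).
Proof. by rewrite /=; case: (eval s e). Qed.

Lemma evalAnd s e f :
  (eval s (eAnd e f) != 0) = (eval s e != 0) && (eval s f != 0).
Proof. by rewrite evalNot /=; case: (eval s e) (eval s f) => [|?] []. Qed.

Lemma evalOr s e f :
  (eval s (eOr e f) != 0) = (eval s e != 0) || (eval s f != 0).
Proof. by rewrite /= addn_eq0 negb_and. Qed.

Lemma evalLe s e f : (eval s (eLe e f) != 0) = (eval s e <= eval s f).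
Proof. by rewrite evalNot /= subn_eq0 negbK. Qed.

Lemma evalLt s e f : (eval s (eLt e f) != 0) = (eval s e < eval s f).
Proof. by rewrite evalNot evalLe -ltnNge. Qed.

Lemma evalEq s e f : (eval s (eEq e f) != 0) = (eval s e == eval s f).
Proof. by rewrite evalAnd !evalLe eqn_leq. Qed.

Definition evalE := (evalEq, evalAnd, evalLt, evalLe, evalNot, evalOr).

(** * Invariants, accumulated facts and progress of loops *)

Lemma iteri_inv (T : Type) (I : nat -> T -> Prop) k f m :
  I 0 m -> (forall i m, i < k -> I i m -> I i.+1 (f i m)) -> I k (iteri k f m).
Proof.
move=> I0; elim: k => [//|k IH] If /=.
apply: (If k _ (ltnSn k)); apply: IH => i m' ik; apply: If; exact: ltnW.
Qed.

Section Sweep.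
Variables (T : Type) (I : T -> Prop) (le : T -> T -> Prop).
Hypotheses (le_refl : forall m, le m m)
  (le_trans : forall m1 m2 m3, le m1 m2 -> le m2 m3 -> le m1 m3).

(** [le] limits how the memory may change, so that a fact [Q] that is [stable] under [le], once
    reached in some round, still holds when the loop ends. *)
Definition sweep (f : T -> T) (Q : T -> Prop) :=
  forall m, I m -> [/\ I (f m), le m (f m) & Q (f m)].

Definition stable (Q : T -> Prop) :=
  forall m m', I m -> I m' -> le m m' -> Q m -> Q m'.

Lemma sweep_iteri k (f : nat -> T -> T) (Q : 'I_k -> T -> Prop) :
  (forall i, stable (Q i)) -> (forall i : 'I_k, sweep (f i) (Q i)) ->
  sweep (iteri k f) (fun m => forall i, Q i m).
Proof.
move=> Qs fQ m0 Im0.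
suff [I1 L1 H1] : [/\ I (iteri k f m0), le m0 (iteri k f m0) &
    forall i : 'I_k, i < k -> Q i (iteri k f m0)].
  by split=> // i; exact: H1.
apply: (@iteri_inv _ (fun j m => [/\ I m, le m0 m & forall i : 'I_k, i < j -> Q i m])).
  by [].
move=> i m ik [Im lem Hm]; have [I' l' Q'] := fQ (Ordinal ik) m Im; split=> //.
  exact: le_trans lem l'.
move=> j; rewrite ltnS leq_eqVlt => /orP[/eqP Ej|/Hm]; last exact: Qs.
by have -> : j = Ordinal ik by apply: val_inj.
Qed.

End Sweep.

Lemma sweep_for I le n r x p (Q : 'I_n -> memory -> Prop) :
  (forall m, le m m) -> (forall m1 m2 m3, le m1 m2 -> le m2 m3 -> le m1 m3) ->
  r 0 = n -> (forall i, stable I le (Q i)) ->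
  (forall i : 'I_n, sweep I le (run p (bind r x i)) (Q i)) ->
  sweep I le (run (PFor x 0 p) r) (fun m => forall i, Q i m).
Proof. by move=> lr lt r0 Qs H m; rewrite (run_for _ _ _ r0); exact: sweep_iteri. Qed.

Lemma sweep_seq I le r p q (Q R : memory -> Prop) :
  (forall m1 m2 m3, le m1 m2 -> le m2 m3 -> le m1 m3) -> stable I le Q ->
  sweep I le (run p r) Q -> sweep I le (run q r) R ->
  sweep I le (run (PSeq p q) r) (fun m => Q m /\ R m).
Proof.
move=> lt Qs pQ qR m Im; have [I1 l1 Q1] := pQ m Im; have [I2 l2 R2] := qR _ I1.
by split; [|exact: lt l1 l2|split=> //; exact: Qs l2 Q1].
Qed.

(* [J t] is meant to say that a fixpoint is reached or a potential is at
   least [t]. *)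
Definition advances (J : nat -> memory -> Prop) w f :=
  forall t m, J t m -> J (t + w) (f m).

Lemma advances_for J w r x c p :
  (forall i, advances J w (run p (bind r x i))) ->
  advances J ((r 0 + c) * w) (run (PFor x c p) r).
Proof.
move=> Hp t m Jm /=.
apply: (@iteri_inv _ (fun j => J (t + j * w))); first by rewrite mul0n addn0.
by move=> i m' _ /Hp => /(_ i); rewrite mulSn -addnA [w + _]addnC.
Qed.

(** * Lexicographic transitive orientations *)

Lemma connect_ind (T : finType) (e : rel T) (P : T -> Prop) x :
  P x -> (forall y z, connect e x y -> P y -> e y z -> P z) ->
  forall y, connect e x y -> P y.
Proof.
move=> Px Pe y /connectP[s + ->] {y}.
elim/last_ind: s => [//|s z IH]; rewrite rcons_path last_rcons => /andP[ps ez].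
by apply: Pe (IH ps) ez; apply/connectP; exists s.
Qed.

Section Forcing.
Variables (T : finType) (H : sgraph T).
Local Notation h := (edge H).

(** Gallai's forcing relation: in a transitive orientation, two edges with a common end whose other
    ends are equal or non-adjacent both leave or both enter the common end. *)
Definition forces (p q : T * T) : bool :=
  [&& h p.1 p.2, h q.1 q.2 &
      (p.1 == q.1) && ~~ h p.2 q.2 || (p.2 == q.2) && ~~ h p.1 q.1].

Definition forced := connect forces.

Definition swap (p : T * T) : T * T := (p.2, p.1).

Lemma forces_sym : symmetric forces.
Proof.
move=> p q; rewrite /forces (eq_sym q.1) (eq_sym q.2).
by rewrite (edge_sym H q.2 p.2) (edge_sym H q.1 p.1) andbCA.
Qed.

Lemma forced_sym p q : forced p q = forced q p.
Proof. by apply: sym_connect_sym; exact: forces_sym. Qed.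

Lemma forces_swap p q : forces p q -> forces (swap p) (swap q).
Proof.
by case/and3P=> Hp Hq; rewrite /forces /= !(edge_sym H _.2 _.1) Hp Hq orbC.
Qed.

Lemma forced_swap p q : forced p q -> forced (swap p) (swap q).
Proof.
move: q; apply: connect_ind => [|y z _ IH /forces_swap/connect1]; first exact: connect0.
exact: connect_trans.
Qed.

Lemma forced_edge p q : forced p q -> h p.1 p.2 -> h q.1 q.2.
Proof.
move=> + hp; move: q; apply: connect_ind => // y z _ _.
by case/and3P.
Qed.

(** A transitive ordering [f] takes the same truth value on all pairs of a forcing class, but
    opposite values on [(a, b)] and [(b, a)]. *)
Lemma comparability_forced a b :
  comparability H -> h a b -> ~~ forced (a, b) (b, a).
Proof.
case=> f [[firr ftr ftot] ftrans] hab.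
have fN u v : h u v -> f u v = ~~ f v u.
  move=> huv; have : u != v by apply: contraTneq huv => ->; rewrite edge_irr.
  move=> /ftot; case E: (f u v); case E': (f v u) => //.
  by have := ftr _ _ _ E E'; rewrite firr.
have step u v w : h u v -> h u w -> ~~ h v w -> f u v -> f u w.
  move=> huv huw + fuv; apply: contraR; rewrite edge_sym => nf.
  have fwu : f w u by rewrite fN // edge_sym.
  by apply: (ftrans w u v) => //; rewrite edge_sym.
have forces_f p q : forces p q -> f p.1 p.2 = f q.1 q.2.
  suff imp p' q' : forces p' q' -> f p'.1 p'.2 -> f q'.1 q'.2.
    by move=> pq; apply/idP/idP; apply: imp; rewrite // forces_sym.
  case: p' q' => [u v] [u' v'] /and3P[/= huv hu'v'].
  case/orP=> /andP[/eqP E]; first by move: hu'v'; rewrite -E; exact: step.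
  move: hu'v'; rewrite -E => hu'v nuu' fuv; rewrite fN //; apply: contraL fuv => fvu'.
  by rewrite -fN 1?edge_sym //; apply: step fvu'; rewrite edge_sym.
apply/negP=> ab; have : f a b = f b a.
  suff : forall q, forced (a, b) q -> f a b = f q.1 q.2 by move/(_ _ ab).
  by apply: connect_ind => // y z _ -> /forces_f.
by rewrite fN //; case: (f b a).
Qed.

(** Induction along the forcing chain from [(b, c)]. If a new end were not adjacent to [a], the
    chain could be continued to [(b, a)] or to [(a, c)], which is excluded; so it is adjacent, and
    the edge from [a] to the old end forces the one to the new end. *)
Lemma triangle_lemma a b c b' c' :
  h a b -> h a c -> ~~ forced (b, c) (a, c) -> ~~ forced (b, c) (b, a) ->
  forced (b, c) (b', c') ->
  forced (a, b) (a, b') /\ forced (a, c) (a, c').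
Proof.
move=> hab hac nac nba bc.
suff : forall q, forced (b, c) q ->
    [/\ h a q.1, h a q.2, forced (a, b) (a, q.1) & forced (a, c) (a, q.2)].
  by case/(_ _ bc).
apply: connect_ind => [|[y z] [y' z'] bcyz /= [hy hz fy fz] F].
  by rewrite /forced !connect0.
have /and3P[/= hyz hyz'] := F; case/orP=> /andP[/eqP E].
- rewrite -{y'}E in F hyz' *; move=> nzz'.
  have hz' : h a z'.
    apply: contraNT nba => naz'; apply: connect_trans bcyz _.
    apply: connect_trans (connect1 F) _; rewrite -/forced.
    apply: (@connect_trans _ _ (y, a)).
      by apply: connect1; rewrite /forces /= hyz' eqxx (edge_sym H y) hy (edge_sym H z') naz'.
    rewrite -[connect _ _ _]/(forced _ _) forced_sym.
    exact: (@forced_swap (a, b) (a, y)).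
  split=> //; apply: connect_trans fz (connect1 _).
  by rewrite /forces /= hz hz' eqxx nzz'.
- rewrite -{z'}E in F hyz' *; move=> nyy'.
  have hy' : h a y'.
    apply: contraNT nac => nay'; apply: connect_trans bcyz _.
    apply: connect_trans (connect1 F) _.
    apply: (@connect_trans _ _ (a, z)).
      by apply: connect1; rewrite /forces /= hyz' hz eqxx (edge_sym H y') nay' orbT.
    by rewrite -[connect _ _ _]/(forced _ _) forced_sym.
  split=> //; apply: connect_trans fy (connect1 _).
  by rewrite /forces /= hy hy' eqxx nyy'.
Qed.

End Forcing.

Section LexicographicOrientation.
Variables (n : nat) (H : sgraph 'I_n) (D : rel 'I_n).
Local Notation h := (edge H).

(** [lex_min] is what remains of the lexicographic order of choice: the least vertex of a class of
    arcs is the tail of one of them. *)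
Record lex_orientation : Prop := LexOrientation {
  lex_edge : forall u v, h u v = D u v || D v u;
  lex_asym : forall u v, D u v -> ~~ D v u;
  lex_forced : forall u v u' v', D u v -> forced H (u, v) (u', v') -> D u' v';
  lex_min : forall u v, D u v -> exists x y, forced H (u, v) (x, y) /\
    forall x' y', forced H (u, v) (x', y') -> x <= x' /\ x <= y'
}.

Hypothesis lexD : lex_orientation.

Definition cyclic_triangle u v w := [/\ D u v, D v w & D w u].

Lemma cyclic_triangle_rot u v w : cyclic_triangle u v w -> cyclic_triangle v w u.
Proof. by case. Qed.

Lemma D_edge u v : D u v -> h u v.
Proof. by rewrite (lex_edge lexD) => ->. Qed.

(** The triangle lemma is applied at the apex [w]. Its side conditions hold because a class
    containing [(u, v)] and a reversed side would break asymmetry. *)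
Lemma cyclic_triangle_forced u v w u' v' :
  cyclic_triangle u v w -> forced H (u, v) (u', v') ->
  [/\ cyclic_triangle u' v' w, forced H (v, w) (v', w) & forced H (w, u) (w, u')].
Proof.
case=> Duv Dvw Dwu F.
have [||||Fu Fv] := @triangle_lemma _ H w u v u' v' _ _ _ _ F.
- exact: D_edge.
- by rewrite edge_sym D_edge.
- apply: contraTN Dvw => /(lex_forced lexD Duv); exact: (lex_asym lexD).
- apply: contraTN Dwu => /(lex_forced lexD Duv); exact: (lex_asym lexD).
have {}Fv := forced_swap Fv; split=> //; split.
- exact: (lex_forced lexD Duv).
- exact: (lex_forced lexD Dvw).
- exact: (lex_forced lexD Dwu).
Qed.

Lemma no_cyclic_triangle u v w : ~ cyclic_triangle u v w.
Proof.
move=> tri; have [Duv Dvw Dwu] := tri.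
have [x1 [y1 [F1 M1]]] := lex_min lexD Duv.
have [x2 [y2 [F2 M2]]] := lex_min lexD Dvw.
have [x3 [y3 [F3 M3]]] := lex_min lexD Dwu.
(* The class containing the smallest vertex comes first, and the class of
   [(c, a)] then has the same smallest vertex. *)
have key a b c x y x' y' : cyclic_triangle a b c -> forced H (a, b) (x, y) ->
    forced H (c, a) (x', y') -> x <= x' ->
    (forall p q, forced H (c, a) (p, q) -> x' <= p /\ x' <= q) -> False.
  move=> abc Fab Fca le_x M; have [xyc Fbc Fca'] := cyclic_triangle_forced abc Fab.
  have Ex : x' = x by apply: val_inj; apply/eqP; rewrite eqn_leq le_x; case: (M _ _ Fca') => _ ->.
  (* Moving the side [(c, x)] to [(x, y')] while [y] stays fixed gives [D y x], against [D x y]. *)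
  rewrite Ex in Fca; have Fcx : forced H (c, x) (x, y').
    by move: Fca'; rewrite forced_sym => /connect_trans; apply.
  have [cxy _ _] := cyclic_triangle_forced (cyclic_triangle_rot (cyclic_triangle_rot xyc)) Fcx.
  have [_ _ Dyx] := cxy; have [Dxy _ _] := xyc.
  by have := lex_asym lexD Dxy; rewrite Dyx.
case: (leqP x1 x3) => [le13|/ltnW le31]; first exact: key tri F1 F3 le13 M3.
case: (leqP x3 x2) => [le32|/ltnW le23].
  exact: key (cyclic_triangle_rot (cyclic_triangle_rot tri)) F3 F2 le32 M2.
exact: key (cyclic_triangle_rot tri) F2 F1 (leq_trans le23 le31) M1.
Qed.

(** If [u] and [w] were not adjacent, [D v w] would force [D v u]; if the edge went from [w] to [u],
    the triangle would be cyclic. *)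
Lemma lex_orientation_trans : transitive D.
Proof.
move=> v u w Duv Dvw.
have huw : h u w.
  apply: contraT => nuw; have Dvu : D v u.
    apply: (lex_forced lexD Dvw); apply: connect1.
    by rewrite /forces /= D_edge // edge_sym D_edge // eqxx edge_sym nuw.
  by have := lex_asym lexD Duv; rewrite Dvu.
move: huw; rewrite (lex_edge lexD) => /orP[//|Dwu].
by have [] := @no_cyclic_triangle u v w.
Qed.

End LexicographicOrientation.

(** * Computing the orientation *)

(* Arrays: 0 adjacency of [G]; 1 the orientation; 2 labels [q]; 3 prices [p];
   4 flags of the matched lower nodes; 5 and 6 the two coordinates of the owner
   of an upper node; 7 the values [f m], in column 0; 8 [alpha G] and 9 [n ^ 2],
   in cell (0, 0). *)
Definition eH i j := eAnd (eNot (eEq i j)) (eNot (Get 0 i j)).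

(** Edges of [G] are the non-edges of [H] with distinct ends. The other instances of [forces], where
    the two arcs coincide, add nothing. *)
Definition force_step : prog :=
  let a := Var 7 in let b := Var 8 in let c := Var 9 in
  PSeq
    (PWhen (eAnd (Get 1 a b) (eAnd (eH a c) (Get 0 b c))) (PStore 1 a c (Cst 1)))
    (PWhen (eAnd (Get 1 a b) (eAnd (eH c b) (Get 0 a c))) (PStore 1 c b (Cst 1))).

Definition force_arcs : prog := PFor 7 0 (PFor 8 0 (PFor 9 0 force_step)).

(* [(n + 1) ^ 2] rounds exceed the number of arcs that can be added. *)
Definition orient_step : prog :=
  let x := Var 3 in let y := Var 4 in
  PWhen (eAnd (eH x y) (eAnd (eNot (Get 1 x y)) (eNot (Get 1 y x))))
    (PSeq (PStore 1 x y (Cst 1)) (PFor 5 1 (PFor 6 1 force_arcs))).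

Definition orient : prog := PFor 3 0 (PFor 4 0 orient_step).

Section Orientation.
Variables (n : nat) (G : sgraph 'I_n).
Local Notation H := (compl_graph G).
Hypothesis compH : comparability H.

Definition holds_graph (m : memory) := forall u v : 'I_n, m 0 u v = edge G u v.

Definition arc (m : memory) : rel 'I_n := fun u v => m 1 u v != 0.

Lemma eval_eH r m (i j : expr) (u v : 'I_n) :
  holds_graph m -> eval (State r m) i = u -> eval (State r m) j = v ->
  (eval (State r m) (eH i j) != 0) = edge H u v.
Proof. by move=> gm Ei Ej; rewrite !evalE /= Ei Ej gm eqb0 negbK. Qed.

Lemma arc_upd m (u v : 'I_n) a b : arc (upd m 1 u v 1) a b = (a == u) && (b == v) || arc m a b.
Proof. by rewrite /arc /upd /= -!(inj_eq val_inj) /=; case: andP. Qed.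

Section ForceClass.
Variables (m0 : memory) (x y : 'I_n).
Hypothesis hxy : edge H x y.

Definition target u v := arc m0 u v || forced H (x, y) (u, v).
Hypothesis edge0 : forall u v, arc m0 u v -> edge H u v.
Hypothesis closed0 : forall u v u' v',
  arc m0 u v -> forced H (u, v) (u', v') -> target u' v'.

Lemma target_closed u v u' v' :
  target u v -> forces H (u, v) (u', v') -> target u' v'.
Proof.
move=> /orP[/closed0 c /connect1/c //|F /connect1 F'].
by rewrite /target /forced (connect_trans F F') orbT.
Qed.

Definition force_inv m := [/\ holds_graph m, forall u v, arc m u v -> target u v,
  forall u v, arc m0 u v -> arc m u v & arc m x y].

Definition force_le m m' := forall u v, arc m u v -> arc m' u v.

Definition force_done m := forall u v, target u v -> arc m u v.

Definition force_goal t m :=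
  force_inv m /\ (force_done m \/ t <= #|[set p | arc m p.1 p.2]|).

Lemma force_le_refl m : force_le m m. Proof. by []. Qed.

Lemma force_le_trans m1 m2 m3 : force_le m1 m2 -> force_le m2 m3 -> force_le m1 m3.
Proof. by move=> l l' u v /l/l'. Qed.

Lemma force_le_upd m (u v : 'I_n) : force_le m (upd m 1 u v 1).
Proof. by move=> a b; rewrite arc_upd => ->; rewrite orbT. Qed.

Lemma force_inv_upd m (u v a b : 'I_n) : force_inv m -> arc m a b ->
  forces H (a, b) (u, v) -> force_inv (upd m 1 u v 1).
Proof.
case=> gm sub sup mxy mab F; split=> //.
- move=> u' v'; rewrite arc_upd => /orP[/andP[/eqP-> /eqP->]|/sub//].
  by apply: target_closed F; exact: sub.
- by move=> u' v' /sup; rewrite arc_upd => ->; rewrite orbT.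
- by rewrite arc_upd mxy orbT.
Qed.

Lemma target_edge u v : target u v -> edge H u v.
Proof. by case/orP=> [/edge0|/forced_edge/(_ hxy)]. Qed.

(** [k] is the part of [forces] that the program tests; when [forces] holds without it, the two arcs
    are equal and the arc is already there. [m1] is the memory at the start of the sweep, whose arcs
    are all to be processed. *)
Lemma force_when_sweep r (a b u v : 'I_n) (k : bool) i j e m1 :
  (forall m, eval (State r m) i = u) -> (forall m, eval (State r m) j = v) ->
  (forall m, holds_graph m -> (eval (State r m) e != 0) = arc m a b && k) ->
  (edge H a b -> k -> forces H (a, b) (u, v)) ->
  (forces H (a, b) (u, v) -> k || ((u, v) == (a, b))) ->
  sweep (fun m => force_inv m /\ force_le m1 m) force_le
    (run (PWhen e (PStore 1 i j (Cst 1))) r)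
    (fun m => arc m1 a b -> forces H (a, b) (u, v) -> arc m u v).
Proof.
move=> Ei Ej Ee kF Fk m [im lem]; have [gm sub _ _] := im.
rewrite run_when run_store Ee //; case: ifP => [/andP[mab k1]|nab].
  rewrite Ei Ej; split; last by rewrite arc_upd !eqxx.
  - split; last by apply: force_le_trans lem _; exact: force_le_upd.
    by apply: (force_inv_upd im mab); apply: kF => //; apply: target_edge; exact: sub.
  - exact: force_le_upd.
split=> // /lem mab /Fk; case: (k) nab => /=; first by rewrite mab.
by move=> _ /eqP[-> ->].
Qed.

Lemma force_step_sweep (r : env) (a b c : 'I_n) m1 : r 7 = a -> r 8 = b -> r 9 = c ->
  sweep (fun m => force_inv m /\ force_le m1 m) force_le (run force_step r)
    (fun m => (arc m1 a b -> forces H (a, b) (a, c) -> arc m a c) /\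
              (arc m1 a b -> forces H (a, b) (c, b) -> arc m c b)).
Proof.
move=> ra rb rc; apply: sweep_seq.
- exact: force_le_trans.
- by move=> m m' _ _ l h /h{}h /h; exact: l.
- apply: (@force_when_sweep r a b a c (edge H a c && edge G b c)
    (Var 7) (Var 9) _ _ (fun=> ra) (fun=> rc)).
  + move=> m gm; rewrite evalAnd evalAnd (@eval_eH r m (Var 7) (Var 9) a c gm ra rc) /= ra rb rc.
    by rewrite gm; case: (edge G b c).
  + by move=> hab /andP[hac gbc]; rewrite /forces hab hac eqxx /= gbc andbF.
  + case/and3P=> _ /= hac /orP[/andP[_ nbc]|/andP[/eqP-> _]]; last by rewrite eqxx orbT.
    rewrite hac; case: eqVneq nbc => [->|] /=; first by rewrite eqxx orbT.
    by rewrite negbK => _ ->.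
- apply: (@force_when_sweep r a b c b (edge H c b && edge G a c)
    (Var 9) (Var 8) _ _ (fun=> rc) (fun=> rb)).
  + move=> m gm; rewrite evalAnd evalAnd (@eval_eH r m (Var 9) (Var 8) c b gm rc rb) /= ra rb rc.
    by rewrite gm; case: (edge G a c).
  + by move=> hab /andP[hcb gac]; rewrite /forces hab hcb eqxx /= gac andbF orbT.
  + case/and3P=> _ /= hcb /orP[/andP[/eqP-> _]|/andP[_ nac]]; first by rewrite eqxx orbT.
    rewrite hcb; case: eqVneq nac => [->|] /=; first by rewrite eqxx orbT.
    by rewrite negbK => _ ->.
Qed.

Lemma force_arcs_sweep r m1 : r 0 = n ->
  sweep (fun m => force_inv m /\ force_le m1 m) force_le (run force_arcs r)
    (fun m => forall a b c,
       (arc m1 a b -> forces H (a, b) (a, c) -> arc m a c) /\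
       (arc m1 a b -> forces H (a, b) (c, b) -> arc m c b)).
Proof.
move=> r0; have lr := force_le_refl; have lt := force_le_trans.
apply: sweep_for => // [a m m' _ _ l h b c|a].
  by case: (h b c) => h1 h2; split=> [/h1{}h1 /h1|/h2{}h2 /h2]; exact: l.
apply: sweep_for => // [b m m' _ _ l h c|b].
  by case: (h c) => h1 h2; split=> [/h1{}h1 /h1|/h2{}h2 /h2]; exact: l.
apply: sweep_for => // [c m m' _ _ l [h1 h2]|c].
  by split=> [/h1{}h1 /h1|/h2{}h2 /h2]; exact: l.
exact: force_step_sweep.
Qed.

(** A sweep either adds an arc or leaves the arcs unchanged; in the latter case they are closed
    under forcing and contain the whole class of [(x, y)]. *)
Lemma force_arcs_advances (r : env) : r 0 = n -> advances force_goal 1 (run force_arcs r).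
Proof.
move=> r0 t m [im goal_m].
have [[im' lem] _ hit] := force_arcs_sweep r0 (conj im (@force_le_refl m)).
set m' := run force_arcs r m in im' lem hit *; split=> //.
case: goal_m => [dm|tm]; first by left=> u v /dm; exact: lem.
have [E|NE] := eqVneq [set p | arc m' p.1 p.2] [set p | arc m p.1 p.2].
  left=> u v; have [_ _ sup mxy] := im' => /orP[/sup//|].
  suff : forall q, forced H (x, y) q -> arc m' q.1 q.2 by move=> h /h.
  apply: connect_ind => // [[u1 v1] [u2 v2]] _ a1 F.
  have {}a1 : arc m u1 v1 by move/setP: E => /(_ (u1, v1)); rewrite !inE /= => <-.
  have /and3P[_ _ /orP[]/andP[/= /eqP E' _]] := F; rewrite -E' in F *.
    by have [/(_ a1 F)] := hit u1 v1 v2.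
  by have [_ /(_ a1 F)] := hit u1 v1 u2.
right; rewrite addn1; apply: leq_ltn_trans tm _; apply: proper_card.
rewrite properEneq eq_sym NE; apply/subsetP=> p; rewrite !inE; exact: lem.
Qed.

Lemma force_loop (r : env) : r 0 = n ->
  let m := run (PFor 5 1 (PFor 6 1 force_arcs)) r m0 in
  holds_graph m0 -> arc m0 x y -> holds_graph m /\ forall u v, arc m u v = target u v.
Proof.
move=> r0 m g0 xy0.
have start : force_goal 0 m0.
  split; last by right.
  by split=> // u v uv; rewrite /target uv.
have adv : advances force_goal (n.+1 * (n.+1 * 1)) (run (PFor 5 1 (PFor 6 1 force_arcs)) r).
  rewrite -addn1 -r0; apply: advances_for => i.
  have := @advances_for force_goal 1 (bind r 5 i) 6 1 force_arcs; apply=> j.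
  exact: force_arcs_advances.
have [[gm sub sup _] done_m] := adv _ _ start; split=> // u v; apply/idP/idP; first exact: sub.
case: done_m => [|le]; first exact.
(* Without a fixpoint there would be more arcs than pairs of vertices. *)
have : n.+1 * (n.+1 * 1) <= n * n.
  rewrite add0n in le; apply: leq_trans le _; apply: leq_trans (max_card _) _.
  by rewrite card_prod card_ord.
by lia.
Qed.

End ForceClass.
Record orient_inv (m : memory) : Prop := OrientInv {
  orient_graph : holds_graph m;
  orient_edge : forall u v, arc m u v -> edge H u v;
  orient_asym : forall u v, arc m u v -> ~~ arc m v u;
  orient_forced : forall u v u' v',
    arc m u v -> forced H (u, v) (u', v') -> arc m u' v';
  orient_min : forall u v, arc m u v -> exists x y, forced H (u, v) (x, y) /\
    forall x' y', forced H (u, v) (x', y') -> x <= x' /\ x <= y'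
}.

Definition oriented m u v := edge H u v -> arc m u v || arc m v u.

(** The old arcs are a union of classes, so the class of the unoriented edge [xy] is new as a whole.
    All edges at vertices below [x] are oriented already, so [x] is the least vertex of that class,
    as [lex_min] demands. *)
Lemma orient_stepP (r : env) (x y : 'I_n) m : r 0 = n -> r 3 = x -> r 4 = y ->
  orient_inv m -> (forall u v : 'I_n, u < x -> oriented m u v) ->
  let m' := run orient_step r m in
  [/\ orient_inv m', force_le m m' & oriented m' x y].
Proof.
move=> r0 rx ry inv_m before m'; rewrite {}/m' /orient_step run_when evalAnd.
have [gm em am fm mm] := inv_m.
rewrite (@eval_eH r m (Var 3) (Var 4) x y gm rx ry).
have -> : (eval (State r m) (eAnd (eNot (Get 1 (Var 3) (Var 4))) (eNot (Get 1 (Var 4) (Var 3)))) != 0)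
    = ~~ arc m x y && ~~ arc m y x by rewrite !evalE /= rx ry.
case: ifP => [/and3P[hxy nxy nyx]|nxy]; last first.
  by split=> // hxy; move: nxy; rewrite hxy /= -negb_or => /negbFE.
rewrite run_seq run_store /= rx ry -/(run (PFor 5 1 (PFor 6 1 force_arcs)) r (upd m 1 x y 1)).
set m0 := upd m 1 x y 1; set m' := run _ r m0.
have [] := @force_loop m0 x y hxy _ _ r r0.
- by move=> u v; rewrite arc_upd => /orP[/andP[/eqP-> /eqP->]|/em].
- move=> u v u' v'; rewrite arc_upd /target arc_upd => /orP[/andP[/eqP-> /eqP->] ->|]; first by rewrite orbT.
  by move=> /fm h /h ->; rewrite orbT.
- by move=> u v; exact: gm.
- by rewrite arc_upd !eqxx.
rewrite -/m' => gm'; rewrite /target => arcE0.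
have arcE u v : arc m' u v = arc m u v || forced H (x, y) (u, v).
  rewrite arcE0 arc_upd; have [/andP[/eqP-> /eqP->]|//] := boolP (_ && _).
  by rewrite /forced connect0 !orbT.
have disj u v : arc m u v -> ~~ forced H (x, y) (u, v).
  by move=> uv; apply/negP; rewrite forced_sym => /(fm _ _ _ _ uv); apply/negP.
split; first split=> //.
- by move=> u v; rewrite arcE => /orP[/em//|/forced_edge/(_ hxy)].
- move=> u v; rewrite !arcE negb_or => /orP[uv|F].
    rewrite am //=; apply/negP=> /forced_swap; rewrite forced_sym => /(fm _ _ _ _ uv).
    exact/negP.
  apply/andP; split; last first.
    (* Both orientations of one edge in the new class would link [(x, y)] to [(y, x)]. *)
    apply/negP=> F'; have := comparability_forced compH hxy; apply/negP/negPn.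
    by apply: connect_trans F' _; rewrite -[connect _ _ _]/(forced _ _ _) forced_sym; apply: (@forced_swap _ _ (x, y) (u, v)).
  apply/negP=> vu; have := nyx; apply/negP/negPn; apply: fm vu _.
  by rewrite forced_sym; exact: (@forced_swap _ _ (x, y) (u, v)).
- move=> u v u' v'; rewrite !arcE => /orP[uv /(fm _ _ _ _ uv)->//|F F'].
  by rewrite /forced (connect_trans F F') orbT.
- move=> u v; rewrite arcE => /orP[/mm//|F]; exists x, y; split; first by rewrite forced_sym.
  move=> x' y' F'; have hF : forced H (x, y) (x', y') by exact: connect_trans F F'.
  have hx'y' := forced_edge hF hxy.
  have nx'y' : ~~ arc m x' y' by apply/negP=> /disj; rewrite hF.
  have ny'x' : ~~ arc m y' x'.
    apply/negP=> yx'; have := nyx; apply/negP/negPn; apply: fm yx' _.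
    by rewrite forced_sym; exact: (@forced_swap _ _ (x, y) (x', y')).
  (* An end below [x] would mean that this edge was oriented earlier, in one direction or the
     other. *)
  split; rewrite leqNgt; apply/negP=> lt.
    by have := before _ _ lt hx'y'; rewrite (negPf nx'y') (negPf ny'x').
  have := before y' x' lt; rewrite /oriented edge_sym => /(_ hx'y').
  by rewrite (negPf nx'y') (negPf ny'x').
- by move=> u v uv; rewrite arcE uv.
- by rewrite /oriented arcE /forced connect0 orbT.
Qed.

Lemma orientP (r : env) m : r 0 = n -> holds_graph m ->
  (forall u v, ~~ arc m u v) ->
  let m' := run orient r m in holds_graph m' /\ lex_orientation H (arc m').
Proof.
move=> r0 gm narc m'.
suff [inv_m' H'] : orient_inv m' /\ forall u v : 'I_n, u < n -> oriented m' u v.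
  have [g e a f mi] := inv_m'; split=> //; split=> // u v.
  apply/idP/orP => [huv|[/e//|/e]]; last by rewrite edge_sym.
  by apply/orP; exact: H'.
rewrite /m' /orient (run_for _ _ _ r0).
apply: (@iteri_inv _ (fun i m => orient_inv m /\ forall u v : 'I_n, u < i -> oriented m u v)).
  by split=> //; split=> // u v; rewrite (negPf (narc u v)).
move=> x m1 xn [inv1 H1]; rewrite (@run_for (bind r 3 x) n) //.
have [||inv2 H2 H3] := @iteri_inv _ (fun j m => [/\ orient_inv m,
   forall u v : 'I_n, u < x -> oriented m u v &
   forall u v : 'I_n, u = x :> nat -> v < j -> oriented m u v])
  n (fun i => run orient_step (bind (bind r 3 x) 4 i)) m1 => //.
- move=> y m2 yn [inv2 H2 H3].
  have [inv3 l3 o3] := @orient_stepP (bind (bind r 3 x) 4 y) (Ordinal xn) (Ordinal yn) m2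
    r0 erefl erefl inv2 H2.
  have mono u v : oriented m2 u v -> oriented (run orient_step (bind (bind r 3 x) 4 y) m2) u v.
    by move=> h /h /orP[] /l3 ->; rewrite ?orbT.
  split=> // [u v /H2/mono //|u v Eu]; rewrite ltnS leq_eqVlt => /orP[/eqP Ev|/(H3 _ _ Eu)/mono//].
  have -> : u = Ordinal xn by exact: val_inj.
  by have -> : v = Ordinal yn by exact: val_inj.
split=> // u v; rewrite ltnS leq_eqVlt => /orP[/eqP Eu|/H2//].
exact: H3.
Qed.

End Orientation.

(** * Unions of antichains *)

Definition antichain (X : finType) (lt : rel X) (A : {set X}) :=
  {in A &, forall x y, ~~ lt x y}.

(** Sizes are compared through complements, because a matching acts on the nodes outside the
    unmatched ones. *)
Lemma leq_card_diff (X : finType) (V A B : {set X}) (f : X -> X) :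
  A \subset V -> {in V :\: A, forall x, f x \in V :\: B} ->
  {in V :\: A &, injective f} -> B \subset V -> #|B| <= #|A|.
Proof.
move=> AV fV finj BV; have : #|f @: (V :\: A)| <= #|V :\: B|.
  by apply: subset_leq_card; apply/subsetP=> _ /imsetP[x xA ->]; exact: fV.
rewrite (card_in_imset finj) !cardsD (setIidPr AV) (setIidPr BV).
by have := subset_leq_card AV; have := subset_leq_card BV; lia.
Qed.

(** * Duality between matchings with prices and antichains *)

Section Labels.
Variables (X : finType) (lt : rel X) (V : {set X}) (L : nat).
Variables (q p : X -> nat) (own : rel X).

(* [q] labels the lower copy and [p] the upper copy of each node in the
   bipartite graph of [lt]; [own y x] says that [x] is matched to [y], which is
   meaningful only when [p y] is positive. *)
Record price_inv : Prop := PriceInv {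
  price_le : forall x y, lt x y -> q x <= p y;
  price_own : forall y, 0 < p y -> exists x, own y x;
  price_tight : forall x y, 0 < p y -> own y x -> lt x y /\ p y = (q x).+1;
  price_inj : forall x y y', 0 < p y -> 0 < p y' -> own y x -> own y' x -> y = y'
}.

Hypotheses (ltV : forall x y, lt x y -> (x \in V) && (y \in V))
  (lt_trans : transitive lt)
  (own_fun : forall x x' y, own y x -> own y x' -> x = x')
  (inv : price_inv)
  (saturated : forall x, q x <= L -> exists2 y, 0 < p y & own y x)
  (cardX : #|X| <= L).

Definition unmatched := [set y in V | p y == 0].

Lemma unmatchedV : unmatched \subset V.
Proof. by apply/subsetP=> y; rewrite inE => /andP[]. Qed.

(** A matched upper node is sent to itself if it lies above a member of [A], and to its owner
    otherwise; both avoid [A]. If a node above [A] were the owner of another node, transitivity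
    would put that one above [A] too, so the map is injective. *)
Lemma antichain_le_unmatched (A : {set X}) :
  A \subset V -> antichain lt A -> #|A| <= #|unmatched|.
Proof.
move=> AV antiA; pose above y := [exists a in A, lt a y].
pose owner y := odflt y [pick x | own y x].
have ownerP y : 0 < p y -> own y (owner y).
  move=> /(price_own inv)[x yx]; rewrite /owner; case: pickP => //= /(_ x).
  by rewrite yx.
apply: (@leq_card_diff _ V _ _ (fun y => if above y then y else owner y)) => //.
- exact: unmatchedV.
- move=> y; rewrite !inE negb_and => /andP[/orP[/negP//|]]; rewrite -lt0n => py yV.
  case: ifPn => ab.
    rewrite yV andbT; apply/negP=> yA; case/exists_inP: ab => a aA.
    by apply/negP; exact: antiA.
  have [ly _] := price_tight inv py (ownerP y py); have /andP[-> _] := ltV ly.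
  rewrite andbT; apply: contra ab => oA; apply/exists_inP; by exists (owner y).
- move=> y y'; rewrite !inE !negb_and => /andP[/orP[/negP//|]]; rewrite -lt0n => py yV.
  case/andP=> /orP[/negP//|]; rewrite -lt0n => py' y'V.
  have key z z' : 0 < p z' -> above z -> ~~ above z' -> z <> owner z'.
    move=> pz' /exists_inP[a aA az] nab E; case/negP: nab; apply/exists_inP; exists a => //.
    by apply: lt_trans az _; rewrite E; case: (price_tight inv pz' (ownerP _ pz')).
  case: ifPn => ay; case: ifPn => ay' //; first by move/key; case.
    by move/esym/key; case.
  by move=> E; apply: (price_inj inv py py' (ownerP _ py)); rewrite E; exact: ownerP.
Qed.

(** Pigeonhole: at most [L] nodes carry prices, and there are [L + 1] levels. *)
Lemma price_gap : exists l, [/\ 0 < l, l <= L.+1 & forall y, p y != l].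
Proof.
have [|] := boolP [exists l : 'I_L.+1, [forall y, p y != l.+1]].
  by case/existsP=> l /forallP H; exists l.+1; rewrite ltn_ord.
rewrite negb_exists => /forallP H.
suff : size (iota 1 L.+1) <= size (map p (enum X)).
  by rewrite size_iota size_map -cardE leqNgt ltnS cardX.
apply: uniq_leq_size; first exact: iota_uniq.
move=> l; rewrite mem_iota => /andP[l0 lL].
have lL' : l.-1 < L.+1 by lia.
have := H (Ordinal lL'); rewrite negb_forall => /existsP[y].
by rewrite negbK /= prednK // => /eqP <-; rewrite map_f // mem_enum.
Qed.

Lemma antichain_ge_unmatched :
  exists2 B : {set X}, B \subset V & antichain lt B /\ #|unmatched| <= #|B|.
Proof.
have [l [l0 lL gap]] := price_gap.
exists [set z in V | p z < l <= q z].
  by apply/subsetP=> y; rewrite inE => /andP[].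
split.
  move=> x y; rewrite !inE => /and3P[_ _ lx] /and3P[_ yl _]; apply/negP=> /(price_le inv).
  by lia.
pose mate x := odflt x [pick y | (0 < p y) && own y x].
have mateP x : q x < l -> 0 < p (mate x) /\ own (mate x) x.
  move=> qx; have [|y py yx] := saturated (x := x); first by lia.
  by rewrite /mate; case: pickP => [z /andP[]//|/(_ y)]; rewrite py yx.
apply: (@leq_card_diff _ V _ _ (fun z => if l < p z then z else mate z)); rewrite ?unmatchedV //.
- by apply/subsetP=> y; rewrite inE => /andP[].
- move=> z; rewrite !inE negb_and => /andP[/orP[/negP//|zl] zV].
  case: ifPn => pz; first by rewrite zV; lia.
  have qz : q z < l by have := gap z; move: zl pz zV; lia.
  have [pm om] := mateP z qz; have [/ltV/andP[_ ->] _] := price_tight inv pm om.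
  by rewrite andbT -lt0n.
- move=> z z'; rewrite !inE !negb_and => /andP[/orP[/negP//|zl] zV].
  case/andP=> [/orP[/negP//|zl'] zV'].
  have key y : ~~ (l < p y) -> ~~ (p y < l) || ~~ (l <= q y) -> p (mate y) < l /\ own (mate y) y.
    move=> py yl; have qy : q y < l by have := gap y; move: yl py; lia.
    have [pm om] := mateP y qy; split=> //; have [_ E] := price_tight inv pm om.
    by have := gap (mate y); rewrite E; lia.
  case: ifPn => pz; case: ifPn => pz' //.
  + by move=> E; have [] := key _ pz' zl'; rewrite -E; lia.
  + by move=> E; have [] := key _ pz zl; rewrite E; lia.
  + move=> E; have [_ o1] := key _ pz zl; have [_ o2] := key _ pz' zl'.
    by rewrite E in o1; exact: own_fun o1 o2.
Qed.

End Labels.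

(** * Saks's theorem: families of antichains as antichains of a product *)

Section Saks.
Variables (n : nat) (G : sgraph 'I_n) (D : rel 'I_n) (m : nat).
Local Notation node := ('I_n * 'I_n)%type.
Local Notation h := (edge (compl_graph G)).

Hypotheses (Dh : forall u v, h u v = D u v || D v u)
  (Dasym : forall u v, D u v -> ~~ D v u) (Dtrans : transitive D).

(** The strict product order of [D] and a chain of length [m], cut out of ['I_n]. Testing [y.2 < m]
    suffices since second coordinates do not decrease. *)
Definition node_lt : rel node := fun x y =>
  (y.2 < m) && (D x.1 y.1 && (x.2 <= y.2) || (x.1 == y.1) && (x.2 < y.2)).

Definition nodes : {set node} := [set x : node | x.2 < m].

Definition alpha_le (W : {set 'I_n}) :=
  forall I : {set 'I_n}, I \subset W -> independent G I -> #|I| <= m.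

Lemma node_lt_nodes x y : node_lt x y -> (x \in nodes) && (y \in nodes).
Proof.
rewrite !inE => /andP[ym /orP[] /andP[_]]; move: ym; lia.
Qed.

Lemma node_lt_trans : transitive node_lt.
Proof.
move=> y x z /andP[ym xy] /andP[zm yz]; rewrite /node_lt zm /=.
case/orP: xy => /andP[xy lxy]; case/orP: yz => /andP[yz lyz].
- by rewrite (Dtrans xy yz) (leq_trans lxy lyz).
- by rewrite -(eqP yz) xy (leq_trans lxy (ltnW lyz)).
- by rewrite (eqP xy) yz (leq_trans (ltnW lxy) lyz).
- by rewrite (eqP xy) yz (ltn_trans lxy lyz) orbT.
Qed.

Lemma Dirr u : D u u = false.
Proof. by apply/negP=> Duu; have := Dasym Duu; rewrite Duu. Qed.

Lemma nonadjacent u v : u != v -> ~~ edge G u v -> D u v || D v u.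
Proof. by move=> uv nuv; rewrite -Dh /= uv. Qed.

(** Nodes over the same vertex form a chain, so the first projection is injective on [A]. Vertices
    of an independent set are pairwise comparable under [D], so their nodes in [A] lie on distinct
    levels, of which there are [m]. *)
Lemma antichain_family (A : {set node}) : A \subset nodes -> antichain node_lt A ->
  exists2 W : {set 'I_n}, #|W| = #|A| & alpha_le W.
Proof.
move=> AV antiA.
have fst_inj : {in A &, injective fst}.
  move=> [u i] [v j] iA jA /= E; subst v.
  have im : i < m by have := subsetP AV _ iA; rewrite inE.
  have jm : j < m by have := subsetP AV _ jA; rewrite inE.
  have := antiA _ _ iA jA; have := antiA _ _ jA iA.
  rewrite /node_lt /= eqxx Dirr im jm /= -!leqNgt => ij ji.
  by congr pair; apply: val_inj; apply/eqP; rewrite eqn_leq ij ji.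
exists (fst @: A); first exact: card_in_imset.
move=> I IW indI.
pose J := [set x in A | x.1 \in I].
have -> : I = fst @: J.
  apply/setP=> u; apply/idP/imsetP => [uI|[x]]; last by rewrite inE => /andP[_ xI] ->.
  by case/imsetP: (subsetP IW _ uI) => x xA E; exists x; rewrite // inE xA -E.
rewrite card_in_imset; last by move=> x y; rewrite !inE => /andP[xA _] /andP[yA _]; exact: fst_inj.
have snd_inj : {in J &, injective (fun x : node => val x.2)}.
  move=> [u i] [v j]; rewrite !inE /= => /andP[xA uI] /andP[yA vI] /val_inj E; subst j.
  case: (eqVneq u v) => [->//|uv].
  have nuv : ~~ edge G u v by have /forall_inP/(_ u uI)/forall_inP := indI; apply.
  have im : i < m by have := subsetP AV _ xA; rewrite inE.
  have := antiA _ _ xA yA; have := antiA _ _ yA xA.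
  rewrite /node_lt /= im leqnn ltnn !andbF !orbF !andbT /= => /negPf n1 /negPf n2.
  by have := nonadjacent uv nuv; rewrite n1 n2.
have : uniq [seq val x.2 | x <- enum J].
  rewrite map_inj_in_uniq ?enum_uniq // => x y; rewrite !mem_enum; exact: snd_inj.
move=> uq; have := uniq_leq_size uq (s2 := iota 0 m); rewrite size_map size_iota -cardE; apply.
move=> k /mapP[x]; rewrite mem_enum inE => /andP[xA _] ->; rewrite mem_iota /=.
by have := subsetP AV _ xA; rewrite inE.
Qed.

(** Each [v] in [W] is put on level [m - height v], where [height v] is the largest size of a chain
    of [W] with top [v]. Heights increase strictly along [D], so levels decrease and the chosen
    nodes are incomparable. *)
Lemma family_antichain (W : {set 'I_n}) : m <= n -> alpha_le W ->
  exists2 A : {set node}, A \subset nodes & antichain node_lt A /\ #|A| = #|W|.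
Proof.
move=> mn smallW.
pose below v := [pred I : {set 'I_n} | [&& I \subset W, independent G I, v \in I &
  [forall u in I, (u == v) || D u v]]].
pose height v := \max_(I : {set 'I_n} | below v I) #|I|.
have below1 v : v \in W -> below v [set v].
  move=> vW; rewrite /= sub1set vW set11 /=; apply/andP; split.
    by apply/forall_inP=> u /set1P->; apply/forall_inP=> w /set1P->; rewrite edge_irr.
  by apply/forall_inP=> u /set1P->; rewrite eqxx.
have height_le v : height v <= m.
  by apply/bigmax_leqP=> I /and4P[IW indI _ _]; exact: smallW.
have height_gt0 v : v \in W -> 0 < height v.
  move=> vW; apply: (@leq_trans #|[set v]|); first by rewrite cards1.
  apply: (@leq_bigmax_cond _ (below v) (fun I : {set 'I_n} => #|I|)).
  exact: below1.
have height_lt u v : u \in W -> v \in W -> D u v -> height u < height v.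
  move=> uW vW Duv.
  have [|I /and4P[IW indI uI /forall_inP Iu] E] :=
    @eq_bigmax_cond _ [pred I | below u I] (fun I : {set 'I_n} => #|I|).
    by apply/card_gt0P; exists [set u]; exact: below1.
  have Dv w : w \in I -> D w v.
    by move=> /Iu /orP[/eqP->//|Dwu]; exact: Dtrans Dwu Duv.
  have vI : v \notin I by apply/negP=> /Dv; rewrite Dirr.
  have nadj w : w \in I -> ~~ edge G w v.
    move=> /Dv Dwv; have : h w v by rewrite Dh Dwv.
    by case/andP.
  have -> : height u = #|I| by rewrite /height E.
  have <- : #|v |: I| = #|I|.+1 by rewrite cardsU1 vI.
  apply: (@leq_bigmax_cond _ (below v) (fun I : {set 'I_n} => #|I|)).
  apply/and4P; split.
  - by rewrite subUset sub1set vW.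
  - apply/forall_inP=> w /setU1P[->|wI]; apply/forall_inP=> w' /setU1P[->|w'I].
    + by rewrite edge_irr.
    + by rewrite edge_sym nadj.
    + exact: nadj.
    + by move/forall_inP: indI => /(_ _ wI)/forall_inP; apply.
  - exact: setU11.
  - by apply/forall_inP=> w /setU1P[->|/Dv->]; rewrite ?eqxx ?orbT.
(* For [v] in [W] the height is positive, so [m - height v < m <= n] and the default value is not
   taken. *)
pose lvl v : 'I_n := insubd v (m - height v).
have lvlE v : v \in W -> lvl v = m - height v :> nat.
  move=> vW; rewrite val_insubd ifT //; have := height_gt0 v vW; have := height_le v; lia.
exists [set (v, lvl v) | v in W].
  apply/subsetP=> _ /imsetP[v vW ->]; rewrite inE /= lvlE //.
  by have := height_gt0 v vW; have := height_le v; lia.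
split; last by rewrite card_imset // => u v [].
move=> _ _ /imsetP[u uW ->] /imsetP[v vW ->]; rewrite /node_lt /= !lvlE //.
apply/negP=> /andP[_ /orP[]/andP[]].
  move=> /(height_lt _ _ uW vW) lt; have := height_le v; lia.
by move=> /eqP->; rewrite ltnn.
Qed.

End Saks.

(** * The auction *)

Definition eEdge : expr :=
  let v := Var 11 in let i := Var 12 in let u := Var 13 in let j := Var 14 in
  eAnd (eLt j (Var 3))
    (eOr (eAnd (Get 1 v u) (eLe i j)) (eAnd (eEq v u) (eLt i j))).

(** A positive price signals an owner. That owner's flag is cleared before arrays 5 and 6 are
    overwritten. *)
Definition grab : prog :=
  let v := Var 11 in let i := Var 12 in let u := Var 13 in let j := Var 14 in
  PWhen (eAnd (eNot (Get 4 v i)) (eAnd eEdge (eLe (Get 3 u j) (Get 2 v i))))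
    (PSeq (PWhen (Get 3 u j) (PStore 4 (Get 5 u j) (Get 6 u j) (Cst 0)))
    (PSeq (PStore 5 u j v) (PSeq (PStore 6 u j i)
    (PSeq (PStore 4 v i (Cst 1)) (PStore 3 u j (Add (Get 2 v i) (Cst 1))))))).

Definition raise : prog :=
  let v := Var 11 in let i := Var 12 in
  PWhen (eNot (Get 4 v i)) (PStore 2 v i (Add (Get 2 v i) (Cst 1))).

Definition bid : prog :=
  let v := Var 11 in let i := Var 12 in
  PWhen (eAnd (eNot (Get 4 v i)) (eLe (Get 2 v i) (Get 9 (Cst 0) (Cst 0))))
    (PSeq (PFor 13 0 (PFor 14 0 grab)) raise).

Definition bid_round : prog := PFor 11 0 (PFor 12 0 bid).

Lemma ltn_sum_strict (X : finType) (f g : X -> nat) x :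
  (forall z, f z <= g z) -> f x < g x -> \sum_z f z < \sum_z g z.
Proof.
move=> fg fgx; rewrite (bigD1 x) // [ltnRHS](bigD1 x) //= -addSn.
by apply: leq_add => //; apply: leq_sum.
Qed.

Section Auction.
Variables (n : nat) (D : rel 'I_n) (k : nat).
Local Notation node := ('I_n * 'I_n)%type.
Local Notation lt := (node_lt D k).

Definition cell (m : memory) a (x : node) := m a x.1 x.2.

Lemma cell_upd m a (x : node) v b y :
  cell (upd m a x.1 x.2 v) b y = if (b == a) && (y == x) then v else cell m b y.
Proof. by rewrite /cell /upd -pair_eqE /pair_eq -!(inj_eq val_inj). Qed.

Definition owns m : rel node := fun y x => (cell m 5 y == x.1) && (cell m 6 y == x.2).

Lemma owns_fun m x x' y : owns m y x -> owns m y x' -> x = x'.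
Proof.
case: x x' => [u i] [u' i'] /andP[/= /eqP e1 /eqP e2] /andP[/= /eqP e3 /eqP e4].
by congr pair; apply: val_inj; rewrite /= -?e1 -?e2.
Qed.

Definition matched m x := cell m 4 x != 0.

Record auction_inv (m : memory) : Prop := AuctionInv {
  auction_arc : forall u v, arc m u v = D u v;
  auction_cap : m 9 0 0 = n * n;
  auction_price : price_inv lt (cell m 2) (cell m 3) (owns m);
  auction_matched : forall x, matched m x <-> exists2 y, 0 < cell m 3 y & owns m y x;
  auction_bound : forall x, cell m 2 x <= (n * n).+1
}.

Definition potential m := \sum_x (cell m 2 x + cell m 3 x).

Definition settled m x := matched m x || (n * n < cell m 2 x).

(** A label is at most [n * n + 1], and a positive price exceeds the label of its owner by one. *)
Lemma potential_bound m : auction_inv m -> potential m <= n * n * (2 * (n * n) + 3).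
Proof.
move=> [_ _ pr _ bd]; rewrite /potential.
apply: (@leq_trans (\sum_(x : node) (2 * (n * n) + 3))); last first.
  by rewrite sum_nat_const card_prod card_ord.
apply: leq_sum => y _; have := bd y; case: (posnP (cell m 3 y)) => [->|py]; first by lia.
have [x yx] := price_own pr py; have [_ ->] := price_tight pr py yx.
by have := bd x; lia.
Qed.

Record grabbed (m m' : memory) (x y : node) : Prop := Grabbed {
  grab_arc : m' 1 = m 1;
  grab_cap : m' 9 = m 9;
  grab_q : forall z, cell m' 2 z = cell m 2 z;
  grab_p : forall z, cell m' 3 z = if z == y then (cell m 2 x).+1 else cell m 3 z;
  grab_owns : forall z w, owns m' z w = if z == y then w == x else owns m z w;
  grab_matched : forall w, matched m' w =
    (w == x) || matched m w && ~~ ((0 < cell m 3 y) && owns m y w)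
}.

(** The price of [y] only rises, which preserves [price_le]; [x] owned nothing before, which
    preserves [price_inj]. *)
Lemma grabbed_inv m m' x y : auction_inv m -> ~~ matched m x -> lt x y ->
  cell m 3 y <= cell m 2 x -> grabbed m m' x y -> auction_inv m'.
Proof.
case=> ha hc pr hm hb nx xy pq [ga gc gq gp go gm].
have nown z : 0 < cell m 3 z -> owns m z x -> False.
  by move=> pz oz; case/negP: nx; apply/hm; exists z.
split.
- by move=> u v; rewrite /arc ga; exact: ha.
- by rewrite gc.
- split.
  + move=> a b ab; rewrite gq gp; case: eqP => [E|_]; last exact: (price_le pr).
    by rewrite E in ab; exact: leq_trans (leq_trans (price_le pr ab) pq) (leqnSn _).
  + move=> z; rewrite gp; case: eqP => [->|/eqP/negPf zy] pz.
      by exists x; rewrite go !eqxx.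
    by have [w ow] := price_own pr pz; exists w; rewrite go zy.
  + move=> w z; rewrite gp go gq; case: eqP => [->|_]; last exact: (price_tight pr).
    by move=> _ /eqP->.
  + move=> w z z'; rewrite !gp !go; case: eqP => [->|_]; case: eqP => [->|_] //.
    * by move=> _ pz' /eqP-> /(nown _ pz').
    * by move=> pz _ oz /eqP E; case: (nown _ pz); rewrite -E.
    * exact: (price_inj pr).
- move=> w; rewrite gm; split.
    case: eqVneq => [->|wx] /=; first by exists y; rewrite ?gp ?go !eqxx.
    case/andP=> /hm[z pz oz] N; exists z; rewrite ?gp ?go; case: eqP => // E.
    by case/negP: N; rewrite -E pz oz.
  case=> z; rewrite gp go; case: eqP => [_ _ ->//|/eqP zy pz oz].
  apply/orP; right; apply/andP; split; first by apply/hm; exists z.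
  by apply/negP=> /andP[py oy]; rewrite (price_inj pr pz py oz oy) eqxx in zy.
- by move=> z; rewrite gq.
Qed.

Lemma grabP (r : env) (x y : node) m :
  r 3 = k -> r 11 = x.1 -> r 12 = x.2 -> r 13 = y.1 -> r 14 = y.2 ->
  auction_inv m ->
  if [&& ~~ matched m x, lt x y & cell m 3 y <= cell m 2 x]
  then grabbed m (run grab r m) x y else run grab r m = m.
Proof.
move=> rk rv ri ru rj inv_m; rewrite /grab !run_when.
set c := eval _ _ != 0.
have -> : c = [&& ~~ matched m x, lt x y & cell m 3 y <= cell m 2 x].
  rewrite /c !evalE /= rk rv ri ru rj -[m 4 _ _]/(cell m 4 x) -/(matched m x).
  rewrite -[m 1 _ _ != 0]/(arc m x.1 y.1) (auction_arc inv_m) /node_lt.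
  done.
have [/and3P[nx xy pq]|//] := boolP [&& _, _ & _].
rewrite !run_seq run_when !run_store /= rv ri ru rj.
set m1 := if m 3 y.1 y.2 != 0 then _ else m.
have m1E b z : b != 4 -> cell m1 b z = cell m b z.
  by move=> b4; rewrite /m1; case: ifP => // _; rewrite /cell /upd (negPf b4).
have m1M w : matched m1 w = matched m w && ~~ ((0 < cell m 3 y) && owns m y w).
  rewrite /matched /m1 lt0n -[m 3 _ _]/(cell m 3 y); case: ifP => _; last by rewrite andbT.
  rewrite /cell /upd /= /owns /cell (eq_sym (m 5 _ _)) (eq_sym (m 6 _ _)).
  by case: (_ && _); rewrite ?andbF ?andbT.
have m11 : m1 1 = m 1 by rewrite /m1; case: ifP.
have m19 : m1 9 = m 9 by rewrite /m1; case: ifP.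
set m2 := upd (upd (upd m1 _ _ _ _) _ _ _ _) _ _ _ _.
have -> : m2 2 x.1 x.2 = cell m 2 x by rewrite -[LHS]/(cell m1 2 x) m1E.
rewrite addn1; split=> //.
- by move=> z; rewrite -[LHS]/(cell m1 2 z) m1E.
- by move=> z; rewrite cell_upd /=; case: eqP => // _; rewrite -[LHS]/(cell m1 3 z) m1E.
- move=> z w; rewrite /owns !cell_upd /=; case: (z =P y) => [_|_]; last by rewrite !m1E.
  by rewrite (eq_sym w).
- move=> w; rewrite /matched !cell_upd /=; case: (w =P x) => //= _; exact: m1M.
Qed.

Definition auction_le x m m' :=
  [/\ forall z, cell m' 2 z = cell m 2 z, forall z, cell m 3 z <= cell m' 3 z &
       matched m x -> matched m' x].

(** This makes the subsequent [raise] safe: if [x] is still unmatched, all its upper neighbours cost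
    more than its label, so [price_le] survives the increase. During the scan prices never fall and
    labels are fixed, so comparisons made early remain valid. *)
Lemma scan_sweep (r : env) (x : node) m0 : r 0 = n -> r 3 = k -> r 11 = x.1 -> r 12 = x.2 ->
  sweep (fun m => [/\ auction_inv m, potential m0 <= potential m &
                    matched m x -> potential m0 < potential m])
    (auction_le x) (run (PFor 13 0 (PFor 14 0 grab)) r)
    (fun m => forall u j, ~~ matched m x -> lt x (u, j) -> cell m 2 x < cell m 3 (u, j)).
Proof.
move=> r0 rk rv ri.
have le_refl m : auction_le x m m by [].
have le_trans m1 m2 m3 : auction_le x m1 m2 -> auction_le x m2 m3 -> auction_le x m1 m3.
  case=> q1 p1 c1 [q2 p2 c2]; split=> [z|z|/c1/c2//]; first by rewrite q2.
  exact: leq_trans (p1 z) (p2 z).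
have mono y m m' : auction_le x m m' ->
    (~~ matched m x -> lt x y -> cell m 2 x < cell m 3 y) ->
    (~~ matched m' x -> lt x y -> cell m' 2 x < cell m' 3 y).
  case=> q1 p1 c1 h nm' xy; rewrite q1; apply: leq_trans (p1 y); apply: h => //.
  by apply: contra nm'.
apply: sweep_for => // [u m m' _ _ l h j|u]; first exact: mono l (h j).
apply: sweep_for => // [j m m' _ _ l|j]; first exact: mono l.
move=> m [im pm mm]; set r' := bind _ _ _.
have := @grabP r' x (u, j) m rk rv ri erefl erefl im.
have [/and3P[nx xy pq] gr|N ->] := boolP [&& _, _ & _]; last first.
  split=> // nx xy; rewrite ltnNge; apply: contra N => pq; exact/and3P.
have im' := grabbed_inv im nx xy pq gr; have [ga gc gq gp go gm] := gr.
have p_le z : cell m 3 z <= cell (run grab r' m) 3 z.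
  by rewrite gp; case: eqP => // ->; exact: leq_trans pq (leqnSn _).
have pot : potential m < potential (run grab r' m).
  apply: (@ltn_sum_strict _ _ _ (u, j)) => [z|]; rewrite gq ?leq_add2l ?ltn_add2l //.
  by rewrite gp eqxx ltnS.
split; last by rewrite gm eqxx.
  by split=> // [|_]; [apply: leq_trans pm (ltnW pot)|apply: leq_ltn_trans pm pot].
by split=> //; rewrite gm eqxx.
Qed.

Lemma bidP (r : env) (x : node) m : r 0 = n -> r 3 = k -> r 11 = x.1 -> r 12 = x.2 ->
  auction_inv m -> let m' := run bid r m in
  auction_inv m' /\ (~~ settled m x /\ potential m < potential m' \/ m' = m /\ settled m x).
Proof.
move=> r0 rk rv ri im m'; rewrite {}/m' /bid run_when.
set c := eval _ _ != 0.
have -> : c = ~~ settled m x.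
  by rewrite /c !evalE /= rv ri (auction_cap im) negb_or -leqNgt.
rewrite negb_or -leqNgt; have [/andP[nx qx]|] := boolP (_ && _); last first.
  by rewrite negb_and negbK -ltnNge => sx; split=> //; right.
rewrite run_seq; have := @scan_sweep r x m r0 rk rv ri m.
case=> [|[im1 pm mm] [q1 p1 c1] hit]; first by split=> // /(negP nx).
set m1 := run _ r m in im1 pm mm q1 p1 c1 hit *.
rewrite /raise run_when run_store.
have -> : (eval (State r m1) (eNot (Get 4 (Var 11) (Var 12))) != 0) = ~~ matched m1 x.
  by rewrite evalNot /= rv ri.
have [mx|nmx] := boolP (matched m1 x); first by split=> //; left; split=> //; exact: mm.
rewrite /= rv ri -[m1 2 _ _]/(cell m1 2 x) addn1.
set m2 := upd _ _ _ _ _.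
have q2 z : cell m2 2 z = if z == x then (cell m1 2 x).+1 else cell m1 2 z.
  by rewrite cell_upd.
case: (im1) => ha hc pr hm hb.
have nown y : 0 < cell m1 3 y -> owns m1 y x -> False.
  by move=> py oy; case/negP: nmx; apply/hm; exists y.
split; last first.
  left; split=> //; apply: leq_ltn_trans pm _; apply: (@ltn_sum_strict _ _ _ x) => [z|].
    rewrite -[cell m2 3 z]/(cell m1 3 z) leq_add2r q2; case: eqP => // ->; exact: leqnSn.
  by rewrite -[cell m2 3 x]/(cell m1 3 x) ltn_add2r q2 eqxx.
split=> //.
- split.
  + move=> a b ab; rewrite q2; case: eqP => [E|_]; last exact: (price_le pr).
    case: b ab => u j ab; apply: hit => //; by rewrite -E.
  + exact: (price_own pr).
  + move=> w z pz oz; rewrite q2; case: eqP => [E|_]; last exact: (price_tight pr).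
    by case: (nown _ pz); rewrite -E.
  + exact: (price_inj pr).
- move=> z; rewrite q2; case: eqP => // _; rewrite q1; exact: qx.
Qed.

(** A round that does not raise the potential leaves the memory unchanged and has found every node
    settled. *)
Lemma bid_round_advances (r : env) : r 0 = n -> r 3 = k ->
  advances (fun t m => auction_inv m /\ ((forall x, settled m x) \/ t <= potential m))
    1 (run bid_round r).
Proof.
move=> r0 rk t m0 [im0 goal0].
(* Later evictions may unsettle a node, so settledness is carried along only while the memory stays
   equal. *)
pose le m m' := m = m' \/ potential m < potential m'.
have le_refl m : le m m by left.
have le_trans m1 m2 m3 : le m1 m2 -> le m2 m3 -> le m1 m3.
  case=> [->//|l1] [<-|l2]; right=> //; exact: ltn_trans l1 l2.
pose I m := [/\ auction_inv m, potential m0 <= potential m & (forall x, settled m0 x) -> m = m0].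
pose Q v i m := potential m0 < potential m \/ settled m (v, i).
have Qs v i : stable I le (Q v i).
  move=> m m' [_ pm _] _ [<-//|l] _; left; exact: leq_ltn_trans pm l.
have := @sweep_for I le n r 11 (PFor 12 0 bid) (fun v m => forall i, Q v i m).
case/(_ le_refl le_trans r0 _ _ m0) => // [v m m' Im Im' l h i|v|[im' pm same] l h].
- exact: Qs Im Im' l (h i).
- apply: sweep_for => // i m [im pm same].
  have [im' H'] := @bidP (bind (bind r 11 v) 12 i) (v, i) m r0 rk erefl erefl im.
  case: H' => [[ns lt]|[-> s]]; last by split=> //; right.
  have lt0 := leq_ltn_trans pm lt.
  split; [split=> //; first exact: ltnW|by right|by left].
  by move=> s; have := s (v, i); rewrite -(same s) (negPf ns).
set m' := run _ _ _ in im' pm same l h *; split=> //.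
have [lt|le'] := ltnP (potential m0) (potential m').
  case: goal0 => [s0|tm]; last by right; rewrite addn1; exact: leq_ltn_trans tm lt.
  by left; rewrite (same s0).
left=> -[v i]; case: (h v i) => //; by rewrite ltnNge le'.
Qed.

End Auction.

(** * The complete program *)

Fixpoint written (p : prog) : seq nat :=
  match p with
  | PStore a _ _ _ => [:: a]
  | PSeq p1 p2 => written p1 ++ written p2
  | PWhen _ p1 | PFor _ _ p1 => written p1
  end.

Lemma run_frame p r m a i j : a \notin written p -> run p r m a i j = m a i j.
Proof.
elim: p r m => [b e1 e2 e3|p1 IH1 p2 IH2|e p1 IH1|x c p1 IH1] r m.
- by rewrite inE /= /upd => /negPf->.
- by rewrite mem_cat negb_or => /andP[h1 h2] /=; rewrite IH2 // IH1.
- by move=> /= h; case: ifP => // _; exact: IH1.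
- move=> /= h; apply: (@iteri_inv _ (fun _ m' => m' a i j = m a i j)) => // l m' _ <-.
  exact: IH1.
Qed.

Definition reset : prog :=
  let v := Var 4 in let i := Var 5 in
  PFor 4 0 (PFor 5 0 (PSeq (PStore 2 v i (Cst 0))
    (PSeq (PStore 3 v i (Cst 0)) (PStore 4 v i (Cst 0))))).

(* [(n + 2) ^ 5] rounds exceed the bound [n ^ 2 * (2 * n ^ 2 + 3)] on the sum of
   all labels and prices. *)
Definition auction : prog :=
  PSeq reset (PFor 6 2 (PFor 7 2 (PFor 8 2 (PFor 9 2 (PFor 10 2 bid_round))))).

Definition count_step : prog :=
  let k := Var 3 in let v := Var 4 in let i := Var 5 in
  PWhen (eAnd (eLt i k) (eNot (Get 3 v i)))
    (PStore 7 k (Cst 0) (Add (Get 7 k (Cst 0)) (Cst 1))).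

Definition count_free : prog := PFor 4 0 (PFor 5 0 count_step).

(** Counts the [k] with [f k < n], which are exactly those below [alpha G]. *)
Definition tally : prog :=
  PWhen (eLt (Get 7 (Var 3) (Cst 0)) (Var 0))
    (PStore 8 (Cst 0) (Cst 0) (Add (Get 8 (Cst 0) (Cst 0)) (Cst 1))).

(** The machine has no multiplication, so [n ^ 2] is obtained by counting. *)
Definition square : prog :=
  PFor 3 0 (PFor 4 0
    (PStore 9 (Cst 0) (Cst 0) (Add (Get 9 (Cst 0) (Cst 0)) (Cst 1)))).

Definition level : prog := PSeq auction (PSeq count_free tally).

Definition solver : prog := PSeq orient (PSeq square (PFor 3 1 level)).

(** The sum of truncated differences vanishes iff both inequalities hold, so a nonzero test means
    rejection. *)
Definition decide : cmd :=
  let alpha := Get 8 (Cst 0) (Cst 0) in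
  If (Add (Defs.Sub (Var 1) alpha)
       (Defs.Sub (Var 0) (Add (Var 2) (Get 7 (Defs.Sub alpha (Var 1)) (Cst 0)))))
    (Assign 0 (Cst 0)) (Assign 0 (Cst 1)).

Lemma squareP (r : env) n m : r 0 = n -> m 9 0 0 = 0 -> run square r m 9 0 0 = n * n.
Proof.
move=> r0 m0; rewrite (run_for _ _ _ r0).
apply: (@iteri_inv _ (fun j m => m 9 0 0 = j * n)); first by rewrite m0.
move=> i m1 _ E; rewrite (@run_for (bind r 3 i) n) // mulSn addnC -E.
apply: (@iteri_inv _ (fun j m => m 9 0 0 = m1 9 0 0 + j)); first by rewrite addn0.
by move=> j m2 _ E2; rewrite /= /upd /= E2 addn1 addnS.
Qed.

Lemma count_free_other (r : env) k m : r 3 != k -> run count_free r m 7 k 0 = m 7 k 0.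
Proof.
move=> rk; rewrite /count_free (run_for _ _ _ erefl).
apply: (@iteri_inv _ (fun _ m' => m' 7 k 0 = m 7 k 0)) => // u m1 _ <-.
rewrite (run_for _ _ _ erefl); apply: (@iteri_inv _ (fun _ m' => m' 7 k 0 = m1 7 k 0)) => // i m2 _ <-; cbv beta.
rewrite /count_step run_when run_store; case: ifP => // _.
by rewrite /upd /= (eq_sym k) (negPf rk).
Qed.

Section Rounds.
Variables (n : nat) (D : rel 'I_n) (k : nat).
Local Notation node := ('I_n * 'I_n)%type.

Lemma resetP (r : env) m a (x : node) : r 0 = n -> a \in [:: 2; 3; 4] ->
  cell (run reset r m) a x = 0.
Proof.
move=> r0 ha.
pose le m1 m2 := forall b (y : node), cell m1 b y = 0 -> cell m2 b y = 0.
have lr m1 : le m1 m1 by move=> b y.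
have lt m1 m2 m3 : le m1 m2 -> le m2 m3 -> le m1 m3 by move=> l1 l2 b y /l1/l2.
pose I (m : memory) : Prop := true.
pose Q (u i : 'I_n) m := forall b, b \in [:: 2; 3; 4] -> cell m b (u, i) = 0.
have Qs u i : stable I le (Q u i) by move=> m1 m2 _ _ l h b /h/l.
suff /(_ m isT)[_ _ h] : sweep I le (run reset r) (fun m => forall u i, Q u i m).
  by case: x => u i; exact: h.
apply: sweep_for => // [u m1 m2 _ _ l h i|u]; first exact: Qs l (h i).
apply: sweep_for => // i m1 _; split=> //.
  have zero c b (y : node) m2 : cell m2 b y = 0 -> cell (upd m2 c u i 0) b y = 0.
    by move=> yb; apply: (etrans (cell_upd m2 c (u, i) 0 b y)); rewrite yb if_same.
  by move=> b y yb; rewrite !run_seq !run_store /=; do 3! apply: (zero).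
move=> b; rewrite !inE => /or3P[] /eqP->; rewrite !run_seq !run_store /=;
  by rewrite /cell /upd /= !eqxx.
Qed.

Lemma auctionP (r : env) m : r 0 = n -> r 3 = k ->
  (forall u v, arc m u v = D u v) -> m 9 0 0 = n * n ->
  let m' := run auction r m in auction_inv D k m' /\ forall x : node, settled m' x.
Proof.
move=> r0 rk ha hc m'; rewrite {}/m' /auction run_seq.
set m1 := run reset r m.
have z a (x : node) : a \in [:: 2; 3; 4] -> cell m1 a x = 0 by exact: resetP.
have inv1 : auction_inv D k m1.
  split.
  - by move=> u v; rewrite -ha /arc /m1 run_frame.
  - by rewrite /m1 run_frame.
  - by split=> [x y _|y|x y|x y y']; rewrite !z.
  - move=> x; split; first by rewrite /matched z.
    by case=> y; rewrite z.
  - by move=> x; rewrite z.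
pose J t m := auction_inv D k m /\ ((forall x : node, settled m x) \/ t <= potential n m).
have adv : advances J ((n + 2) * ((n + 2) * ((n + 2) * ((n + 2) * ((n + 2) * 1)))))
    (run (PFor 6 2 (PFor 7 2 (PFor 8 2 (PFor 9 2 (PFor 10 2 bid_round))))) r).
  have A c w s x p : s 0 = n -> (forall i, advances J w (run p (bind s x i))) ->
      advances J ((n + c) * w) (run (PFor x c p) s).
    by move=> <-; exact: advances_for.
  do 5! (apply: (A) => // ?); exact: bid_round_advances.
have [inv2 [//|lt]] := adv 0 m1 (conj inv1 (or_intror isT)).
have := leq_trans lt (potential_bound inv2).
by nia.
Qed.

Lemma count_freeP (r : env) m : r 0 = n -> r 3 = k ->
  run count_free r m 7 k 0 = m 7 k 0 + #|unmatched (nodes n k) (cell m 3)|.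
Proof.
move=> r0 rk.
pose g u i := ((i < k) && (m 3 u i == 0) : nat).
have -> : #|unmatched (nodes n k) (cell m 3)| = \sum_(0 <= u < n) \sum_(0 <= i < n) g u i.
  rewrite big_mkord; under eq_bigr => u _ do rewrite big_mkord.
  rewrite pair_big /= -sum1_card big_mkcond /=; apply: eq_bigr => x _.
  by rewrite !inE /g /cell; case: (_ && _).
suff [] : run count_free r m 3 = m 3 /\
  run count_free r m 7 k 0 = m 7 k 0 + \sum_(0 <= u < n) \sum_(0 <= i < n) g u i by [].
rewrite /count_free (run_for _ _ _ r0).
pose S j := \sum_(0 <= u < j) \sum_(0 <= i < n) g u i.
apply: (@iteri_inv _ (fun j m' => m' 3 = m 3 /\ m' 7 k 0 = m 7 k 0 + S j)).
  by rewrite /S big_geq // addn0.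
move=> u m1 _ [m13 m17]; rewrite (@run_for (bind r 4 u) n) //.
rewrite /S big_nat_recr // addnA -/(S u) -m17.
apply: (@iteri_inv _ (fun j m' => m' 3 = m 3 /\ m' 7 k 0 = m1 7 k 0 + \sum_(0 <= i < j) g u i)).
  by rewrite big_geq // addn0.
move=> i m2 _ [m23 m27]; cbv beta; rewrite big_nat_recr // addnA -m27.
have -> : run count_step (bind (bind r 4 u) 5 i) m2 =
    if (i < k) && (m2 3 u i == 0) then upd m2 7 k 0 (m2 7 k 0 + 1) else m2.
  by rewrite /count_step run_when evalAnd evalLt evalNot run_store /= -rk negbK.
rewrite m23 /g.
by case: (_ && _); rewrite ?addn0 // /upd /= eqxx.
Qed.

End Rounds.

(** * Correctness *)

Section Blocker.
Variables (n : nat) (G : sgraph 'I_n).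

Definition max_kept k f :=
  (forall W : {set 'I_n}, alpha_le G k W -> #|W| <= f) /\
  exists2 W : {set 'I_n}, alpha_le G k W & f <= #|W|.

Lemma alpha_le_setT k : alpha_le G k setT <-> alpha G <= k.
Proof.
split=> [h|/bigmax_leqP h I _]; last exact: h.
by apply/bigmax_leqP=> I; apply: h; exact: subsetT.
Qed.

Lemma max_kept_lt k f : max_kept k f -> (f < n) = (k < alpha G).
Proof.
case=> ub [W aW fW]; apply/idP/idP; rewrite !ltnNge; apply: contra => le.
  by move/alpha_le_setT: le => /ub; rewrite cardsT card_ord.
have WT : W = setT.
  by apply/eqP; rewrite eqEcard subsetT cardsT card_ord (leq_trans le fW).
by apply/alpha_le_setT; rewrite -WT.
Qed.

Lemma alpha_le_induced (A : {set 'I_n}) k :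
  alpha_le G k A <-> alpha (induced G A) <= k.
Proof.
split=> [h|/bigmax_leqP h I IA indI].
  apply/bigmax_leqP=> I indI; rewrite -(card_imset _ val_inj); apply: h.
    by apply/subsetP=> _ /imsetP[u _ ->]; exact: valP.
  apply/forall_inP=> _ /imsetP[u uI ->]; apply/forall_inP=> _ /imsetP[v vI ->].
  by move/forall_inP: indI => /(_ _ uI)/forall_inP/(_ _ vI).
have -> : I = val @: [set u : {x | x \in A} | val u \in I].
  apply/setP=> u; apply/idP/imsetP=> [uI|[v]]; last by rewrite inE => vI ->.
  by exists (Sub u (subsetP IA _ uI)); rewrite ?inE.
rewrite card_imset; last exact: val_inj.
apply: h; apply/forall_inP=> u; rewrite inE => uI; apply/forall_inP=> v; rewrite inE => vI.
by move/forall_inP: indI => /(_ _ uI)/forall_inP/(_ _ vI).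
Qed.

(** Blockers are the complements of kept sets. For [d > alpha G] the bound on the independence
    number is negative and no blocker exists. *)
Lemma blocker_max_kept d k f : max_kept (alpha G - d) f ->
  (d <= alpha G) && (n <= k + f) <-> deletion_blocker_alpha G d k.
Proof.
case=> ub [W aW fW]; split=> [/andP[da nk]|[S [Sk]]].
  exists (~: W); split.
    by have := cardsC W; rewrite card_ord; move: nk fW; lia.
  rewrite /delete setCK; have /alpha_le_induced := aW; move: da; lia.
move=> le; have da : d <= alpha G by move: le; lia.
rewrite da /=; have /ub : alpha_le G (alpha G - d) (~: S).
  by apply/alpha_le_induced; rewrite -/(delete G S); move: le da; lia.
have := cardsC S; rewrite card_ord; move: Sk; lia.
Qed.

(** Settled nodes with label at most [n * n] are matched, which is the saturation required by the
    duality with [L = n * n]. Saks's correspondence translates both bounds to vertex sets. *)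
Lemma settled_max_kept (D : rel 'I_n) k m : lex_orientation (compl_graph G) D ->
  k <= n -> auction_inv D k m -> (forall x : 'I_n * 'I_n, settled m x) ->
  max_kept k #|unmatched (nodes n k) (cell m 3)|.
Proof.
move=> lexD kn im sm.
have Dtr := lex_orientation_trans lexD.
have [Dh Das _ _] := lexD.
have sat (x : 'I_n * 'I_n) : cell m 2 x <= n * n -> exists2 y, 0 < cell m 3 y & owns m y x.
  move=> qx; apply/(auction_matched im); have := sm x.
  by rewrite /settled ltnNge qx orbF.
have cX : #|{: 'I_n * 'I_n}| <= n * n by rewrite card_prod card_ord.
have ltV := @node_lt_nodes n D k; have ltT := node_lt_trans (m := k) Dtr.
have pr := auction_price im.
split=> [W aW|].
  have [A AV [antiA <-]] := family_antichain Dh Das Dtr kn aW.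
  exact: (antichain_le_unmatched ltV ltT pr).
have [B BV [antiB le]] := antichain_ge_unmatched ltV (@owns_fun n m) pr sat cX.
have [W WB aW] := antichain_family Dh Das BV antiB.
by exists W; rewrite ?WB.
Qed.

Record level_inv (D : rel 'I_n) (j : nat) (m : memory) : Prop := LevelInv {
  level_arc : forall u v, arc m u v = D u v;
  level_cap : m 9 0 0 = n * n;
  level_alpha : m 8 0 0 = minn j (alpha G);
  level_todo : forall k, j <= k -> m 7 k 0 = 0;
  level_done : forall k, k < j -> max_kept k (m 7 k 0)
}.

Lemma levelP (D : rel 'I_n) (r : env) j m : lex_orientation (compl_graph G) D ->
  r 0 = n -> r 3 = j -> j <= n -> level_inv D j m -> level_inv D j.+1 (run level r m).
Proof.
move=> lexD r0 rj jn [mD mc ma mt md].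
rewrite /level !run_seq; set m1 := run auction r m; set m2 := run count_free r m1.
have [im1 sm1] : auction_inv D j m1 /\ forall x : 'I_n * 'I_n, settled m1 x by exact: auctionP.
have kept := settled_max_kept lexD jn im1 sm1.
have m17 k : m1 7 k 0 = m 7 k 0 by rewrite /m1 run_frame.
have m2j : m2 7 j 0 = #|unmatched (nodes n j) (cell m1 3)|.
  by rewrite /m2 (@count_freeP n j) // m17 mt.
have m27 k : k != j -> m2 7 k 0 = m 7 k 0.
  by move=> kj; rewrite -m17; apply: count_free_other; rewrite rj eq_sym.
rewrite -m2j in kept; split.
- by move=> u v; rewrite -(auction_arc im1) /arc run_frame // /m2 run_frame.
- by rewrite run_frame // /m2 run_frame // (auction_cap im1).
- have m28 : m2 8 0 0 = m 8 0 0 by rewrite /m2 run_frame // /m1 run_frame.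
  rewrite /tally run_when evalLt run_store /= rj r0 (max_kept_lt kept).
  by case: ltnP => lt; rewrite /upd /= m28 ma; lia.
- move=> k jk; rewrite run_frame // m27 ?mt ?(ltnW jk) //; lia.
- move=> k; rewrite ltnS leq_eqVlt => /orP[/eqP->|kj]; rewrite run_frame //.
  by rewrite m27; [exact: md|lia].
Qed.

Lemma solverP (r : env) (m : memory) : cocomparability G -> r 0 = n ->
  (forall u v : 'I_n, m 0 u v = edge G u v) -> (forall a i j, 0 < a -> m a i j = 0) ->
  let m' := run solver r m in
  m' 8 0 0 = alpha G /\ forall k, k <= n -> max_kept k (m' 7 k 0).
Proof.
move=> coG r0 g0 z0 m'; rewrite {}/m' /solver !run_seq.
set m1 := run orient r m; set m2 := run square r m1.
have [_ lexD] : holds_graph G m1 /\ lex_orientation (compl_graph G) (arc m1).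
  by apply: orientP => // u v; rewrite /arc z0.
set D : rel 'I_n := arc m1 in lexD.
have m1z a i j : a \notin [:: 0; 1] -> m1 a i j = 0.
  rewrite !inE negb_or => /andP[a0 a1].
  by rewrite /m1 run_frame ?z0 ?lt0n // [written _]/= !inE !negb_or a1.
have m2z a i j : a \in [:: 7; 8] -> m2 a i j = 0.
  by rewrite !inE => /orP[] /eqP->; rewrite /m2 run_frame // m1z.
suff [_ _ E _ kept] : level_inv D (n + 1) (run (PFor 3 1 level) r m2).
  split=> [|k kn]; last by apply: kept; rewrite addn1.
  (* The levels [0, ..., n] suffice because [alpha G <= n]. *)
  rewrite E; apply/minn_idPr; rewrite addn1 ltnW // ltnS.
  by apply/bigmax_leqP=> I _; rewrite -[leqRHS]card_ord max_card.
have : level_inv D 0 m2.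
  split=> [u v|||k|//].
  - by rewrite /D /arc /m2 run_frame.
  - by rewrite /m2 (squareP r0) // m1z.
  - by rewrite m2z // min0n.
  - by rewrite m2z.
move=> inv0; rewrite -{1}r0; apply: (@iteri_inv _ (level_inv D)) => // j m3.
by rewrite r0 addn1 ltnS => jn; exact: levelP.
Qed.

End Blocker.

Theorem theorem30 :
  exists (c : cmd) (p : {poly nat}),
    forall (n : nat) (G : sgraph 'I_n) (d k : nat),
      cocomparability G -> 1 <= d -> 1 <= k ->
      exists (t : nat) (s : state),
        [/\ exec c (input G d k) t s,
            t <= p.[input_size n d k]%R &
            accepts s <-> deletion_blocker_alpha G d k].
Proof.
(* [decide] takes constant time, below 40 together with the sequencing. *)
exists (Seq (compile solver) decide), (time solver + 40%:P)%R => n G d k coG _ _.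
have [t [s [ex le_t as_ vs]]] :=
  @exec_compile [:: 0; 1; 2] solver (input G d k) (vars (input G d k)) isT (fun _ _ => erefl).
have [//|u v|[//|a] //|alphaE kept] :=
  @solverP n G (vars (input G d k)) (arrs (input G d k)) coG.
  by rewrite /= !valK.
rewrite -as_ in alphaE kept.
have [v0 v1 v2] : [/\ vars s 0 = n, vars s 1 = d & vars s 2 = k] by rewrite !vs.
set f := arrs s 7 (alpha G - d) 0.
have kept_f : max_kept G (alpha G - d) f.
  (* The index [alpha G - d] is at most [n], hence among the computed levels. *)
  apply: kept; apply: leq_trans (leq_subr _ _) _.
  by apply/bigmax_leqP=> I _; rewrite -[leqRHS]card_ord max_card.
pose test := Add (Defs.Sub (Var 1) (Get 8 (Cst 0) (Cst 0)))
  (Defs.Sub (Var 0) (Add (Var 2) (Get 7 (Defs.Sub (Get 8 (Cst 0) (Cst 0)) (Var 1)) (Cst 0)))).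
have testE : (eval s test == 0) = (d <= alpha G) && (n <= k + f).
  by rewrite /= v0 v1 v2 alphaE addn_eq0 !subn_eq0.
pose b := eval s test == 0.
exists (t + (cost test + 2).+1).+1, (set_var s 0 b); split.
- apply: exec_seq ex _; rewrite /b; case: eqP => [/eqP E|/eqP E].
    by apply: exec_if_false => //; exact: exec_assign.
  by apply: exec_if_true => //; exact: exec_assign.
- rewrite hornerD hornerC.
  (* The time bound is a polynomial in [n]; being monotone, it may be evaluated at the input
     size. *)
  have le_n : n <= input_size n d k.
    rewrite /input_size -addnA; apply: leq_trans (leq_addr _ _); nia.
  have := leq_trans le_t (leq_horner (time solver) le_n).
  by move=> le; apply: (leq_trans _ (leq_add le (leqnn 40))); rewrite /=; lia.
- apply: iff_trans (blocker_max_kept k kept_f).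
  by rewrite -testE -/b /accepts /=; case: b.
Qed.
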